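(* Let $\omega$ be a modulus of continuity, $X$ an isotropic $L$-space, $t\in[a,b]$, and let $h>\gamma>0$ be given. Let $$\gamma_1=\min\{\gamma,t-a\},\ \gamma_2=\min\{\gamma,b-t\},\ h_1=\min\{h,t-a\},\ h_2=\min\{h,b-t\}.$$ If $\omega$ is concave, then $$E\left(\Delta_{\gamma_1,\gamma_2}(t),\frac2{h_1+h_2}\right)=U\left(\Delta_{\gamma_1,\gamma_2}(t),\Delta_{h_1,h_2}(t)\right)=K(\gamma_1,\gamma_2;h_1,h_2),$$ and for arbitrary $\omega$ $$E\left(\mathcal D_H(t),\frac2{h_1+h_2}\right)=U\left(\mathcal D_H(t),\Delta_{h_1,h_2}(t)\right)=\frac{I(h_1)+I(h_2)}{h_1+h_2}.$$
   Context: A modulus of continuity is a non-decreasing continuous semi-additive function $\omega\colon[0,\infty)\to[0,\infty)$ (i.e. $\omega(s+t)\le\omega(s)+\omega(t)$) with $\omega(0)=0$. $I(\alpha)=\int_0^\alpha\omega(s)\,ds$, and $$K(\gamma_1,\gamma_2;h_1,h_2)=\frac{(h_1-\gamma_1)+(h_2-\gamma_2)}{(h_1+h_2)^2}\left\{I\left(\tfrac{(h_1+h_2)(h_1-\gamma_1)}{(h_1-\gamma_1)+(h_2-\gamma_2)}\right)+I\left(\tfrac{(h_1+h_2)(h_2-\gamma_2)}{(h_1-\gamma_1)+(h_2-\gamma_2)}\right)\right\}$$ (understood as $0$ if $h_1=\gamma_1$ and $h_2=\gamma_2$). A semilinear space is a set $X$ with addition and multiplication by real numbers such that for all $x,y,z\in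 X$, $\alpha,\beta\in\mathbb R$: $x+y=y+x$; $x+(y+z)=(x+y)+z$; there is $\theta\in X$ with $x+\theta=x$ for all $x$; $\alpha(x+y)=\alpha x+\alpha y$; $\alpha(\beta x)=(\alpha\beta)x$; $1\cdot x=x$, $0\cdot x=\theta$. An $L$-space is a semilinear space $X$ with a complete separable metric $h_X$ such that $h_X(\alpha x,\alpha y)=|\alpha|h_X(x,y)$ and $h_X(x+z,y+z)\le h_X(x,y)$; it is isotropic if the last inequality is always an equality. An element $x$ is convex if $(\alpha+\beta)x=\alpha x+\beta x$ for all $\alpha,\beta\ge0$; $X^{\rm c}$ is the set of convex elements. An element $x$ is invertible if there is $x'\in X$ with $x+x'=\theta$; $X^{\rm inv}$ is the set of invertible elements. Standing assumption: $X^{\rm inv}\cap X^{\rm c}\ne\{\theta\}$. $X$ is equipped with a fixed convexifying operator $P$: a surjection $P\colon X\to X^{\rm c}$ with $h_X(P(x),P(y))\le h_X(x,y)$, $P\circ P=P$, $P(\alpha x+\beta y)=\alpha P(x)+\beta P(y)$ for all $x,y\in X$, $\alpha,\beta\in\mathbb R$. Integral: for a simple mapping $f$ taking values $f_1,\dots,f_n$ on pairwise disjoint measurable sets $T_1,\dots,T_n$, $\int f(s)\,ds:=\sum_iP(f_i)\mu(T_i)$ ($\mu$ the Lebesgue measure); for a uniform limit $f$ of simple mappings $f^k$ (in particular for continuous $f$), $\int f:=\lim_k\int f^k$. Hukuhara type difference: $z=x-_Hy$ means $x=y+z$ (unique, if it exists, in an isotropic space). $f$ has Hukuhara type derivative $\mathcal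 D_Hf(t)$ at $t\in(a,b)$ if for all small $\gamma>0$ the differences $f(t+\gamma)-_Hf(t)$, $f(t)-_Hf(t-\gamma)$ exist and the limits as $\gamma\to+0$ of $\gamma^{-1}(f(t+\gamma)-_Hf(t))$ and $\gamma^{-1}(f(t)-_Hf(t-\gamma))$ exist and coincide; $\mathcal D_Hf(t)$ is the common limit (one-sided at $t=a,b$). Divided difference: $\Delta^H_{\gamma_1,\gamma_2}f(t)=\frac{1}{\gamma_1+\gamma_2}\bigl(f(t+\gamma_2)-_Hf(t-\gamma_1)\bigr)$. For fixed $t$, the operators $\Delta_{\gamma_1,\gamma_2}(t)$ and $\mathcal D_H(t)$ act by $\Delta_{\gamma_1,\gamma_2}(t)f=\Delta^H_{\gamma_1,\gamma_2}f(t)$, $\mathcal D_H(t)f=\mathcal D_Hf(t)$. $H^\omega([a,b],X)$ is the class of $f\colon[a,b]\to X$ with $h_X(f(t'),f(t''))\le\omega(|t'-t''|)$ for all $t',t''\in[a,b]$. $W^1H^\omega([a,b],X)$ is the class of functions $f(t)=x+\int_a^t\phi(s)\,ds$ with $\phi\in H^\omega([a,b],X)$, $x\in X^{\rm c}$; for such $f$, $\mathcal D_Hf=P(\phi)$. $\overline W^1H^\omega([a,b],X)=\bigcup_{k>0}k\cdot W^1H^\omega([a,b],X)$. Notation: $\|x\|_X=h_X(x,\theta)$; $C([a,b],X)$ is the space of continuous functions $[a,b]\to X$, $\|f\|_{C([a,b],X)}=\sup_{t\in[a,b]}\|f(t)\|_X$. $C^H([a,b],X)$ is the set of $f\in C([a,b],X)$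 such that $\Delta^H_{\gamma_1,\gamma_2}f(s)$ exists whenever $\gamma_1,\gamma_2>0$ and $[s-\gamma_1,s+\gamma_2]\subset[a,b]$. A positively homogeneous operator $T\colon C^H([a,b],X)\to X$ is bounded if $\|T\|=\sup\{\|Tf\|_X:f\in C^H([a,b],X),\|f\|_{C([a,b],X)}\le1\}<\infty$. For $A\colon\overline W^1H^\omega([a,b],X)\to X$ and such $T$, $U(A,T)=\sup_{f\in W^1H^\omega([a,b],X)}h_X(Af,Tf)$, and for $N>0$, $E(A,N)=\inf_{\|T\|\le N}U(A,T)$, the infimum over bounded positively homogeneous operators $T\colon C^H([a,b],X)\to X$ with $\|T\|\le N$. *)

(* Defs.v *)
From HB Require Import structures.
From mathcomp Require Import all_boot all_order all_algebra.
From mathcomp Require Import all_classical all_reals all_analysis.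

Set Implicit Arguments.
Unset Strict Implicit.
Unset Printing Implicit Defensive.

Import Order.TTheory GRing.Theory Num.Theory.
Import numFieldNormedType.Exports.

Local Open Scope classical_set_scope.
Local Open Scope ring_scope.

Reserved Notation "x +s y" (at level 50, left associativity).
Reserved Notation "a *s x" (at level 40, left associativity).

(* A semilinear space is not an [lSemiModType]: [(a + b) *s x = a *s x +s b *s x]
   is not required.  The addition does not extend [nmodType] because the library
   has no common ancestor from which N-modules and metric spaces can be joined. *)
HB.mixin Record isSemilinear (R : realType) X := {
  theta : X ;
  sladd : X -> X -> X ;
  slscale : R -> X -> X ;
  sladdC : commutative sladd ;
  sladdA : associative sladd ;
  sladdx0 : right_id theta sladd ;
  slscaleDr : forall (a : R) (x y : X),
    slscale a (sladd x y) = sladd (slscale a x) (slscale a y) ;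
  slscaleA : forall (a b : R) (x : X),
    slscale a (slscale b x) = slscale (a * b) x ;
  slscale1 : forall x : X, slscale 1 x = x ;
  slscale0 : forall x : X, slscale 0 x = theta
}.

#[short(type="semilinearType")]
HB.structure Definition Semilinear (R : realType) := { X of isSemilinear R X }.

Arguments theta {R s}.

Notation "x +s y" := (sladd x y) : ring_scope.
Notation "a *s x" := (slscale a x) : ring_scope.

Lemma sladd0x (R : realType) (X : semilinearType R) :
  left_id theta (@sladd R X).
Proof. by move=> x; rewrite sladdC sladdx0. Qed.

HB.instance Definition _ (R : realType) (X : semilinearType R) :=
  Monoid.isComLaw.Build X theta (@sladd R X)
    (@sladdA R X) (@sladdC R X) (@sladd0x R X).

(* The metric h_X is [mdist]. *)
HB.mixin Record Semilinear_Metric_isLSpace (R : realType) X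
    & Semilinear R X & Metric R X & Complete X := {
  mdist_slscale : forall (a : R) (x y : X),
    mdist (a *s x) (a *s y) = `|a| * mdist x y ;
  mdist_sladd_le : forall x y z : X, mdist (x +s z) (y +s z) <= mdist x y ;
  lspace_separable : exists2 D : set X, countable D & dense D
}.

#[short(type="lspaceType")]
HB.structure Definition LSpace (R : realType) :=
  { X of Semilinear R X & Metric R X & Complete X
       & Semilinear_Metric_isLSpace R X }.

Section LSpaceNotions.
Context {R : realType}.

Definition isotropic (X : lspaceType R) :=
  forall x y z : X, mdist (x +s z) (y +s z) = mdist x y.

Context {X : lspaceType R}.

Definition convex_elements : set X :=
  [set x | forall a b : R, 0 <= a -> 0 <= b -> (a + b) *s x = a *s x +s b *s x].

Definition invertible_elements : set X := [set x | exists x', x +s x' = theta].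

Record convexifying_operator (P : X -> X) : Prop := {
  convexifying_surj : range P = convex_elements ;
  convexifying_lip : forall x y, mdist (P x) (P y) <= mdist x y ;
  convexifying_idem : forall x, P (P x) = P x ;
  convexifying_lin : forall (a b : R) x y,
    P (a *s x +s b *s y) = a *s P x +s b *s P y
}.

Definition hnorm (x : X) : R := mdist x theta.

(* Total version of the difference x -_H y, with value theta if it does not exist;
   in an isotropic space there is at most one such z. *)
Definition hdiff (x y : X) : X := xget theta [set z | x = y +s z].

Definition hdiff_exists (x y : X) := exists z, x = y +s z.

End LSpaceNotions.

Section Integral.
Context {R : realType} {X : lspaceType R} (P : X -> X).

(* Lebesgue (not only Borel) measurability. *)
Definition lebesgue_measurable (A : set R) : Prop :=
  ((wlength (R := R) idfun)^*%mu).-cara.-measurable A.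

(* [g] restricted to [D] is simple and its integral over [D] is [v]. *)
Definition simple_integral (D : set R) (g : R -> X) (v : X) : Prop :=
  exists (n : nat) (T : 'I_n -> set R) (c : 'I_n -> X),
    [/\ forall i, lebesgue_measurable (T i),
        trivIset setT T,
        \bigcup_i T i = D,
        forall i s, T i s -> g s = c i
      & v = \big[sladd/theta]_(i < n)
              (fine (completed_lebesgue_measure (T i)) *s P (c i))].

Definition is_integral (D : set R) (f : R -> X) (v : X) : Prop :=
  exists (g : nat -> R -> X) (w : nat -> X),
    [/\ forall k, simple_integral D (g k) (w k),
        {uniform D, g @ \oo --> f}
      & w @ \oo --> v].

End Integral.

Section Modulus.
Context {R : realType}.

(* Functions on [0, +oo[ are represented by functions on R whose values at
   negative arguments are irrelevant. *)
Record modulus_of_continuity (w : R -> R) : Prop := {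
  modulus_ge0 : forall s, 0 <= s -> 0 <= w s ;
  modulus_nondecreasing : forall s t, 0 <= s -> s <= t -> w s <= w t ;
  modulus_continuous : {within `[0, +oo[, continuous w} ;
  modulus_semiadditive :
    forall s t, 0 <= s -> 0 <= t -> w (s + t) <= w s + w t ;
  modulus0 : w 0 = 0
}.

Definition concave_modulus (w : R -> R) : Prop :=
  forall s t l, 0 <= s -> 0 <= t -> 0 <= l -> l <= 1 ->
    l * w s + (1 - l) * w t <= w (l * s + (1 - l) * t).

Definition I_ (w : R -> R) (alpha : R) : R :=
  \int[lebesgue_measure]_(s in `[0, alpha]) w s.

(* If h1 = g1 and h2 = g2, the leading factor makes this 0. *)
Definition K_ (w : R -> R) (g1 g2 h1 h2 : R) : R :=
  ((h1 - g1) + (h2 - g2)) / (h1 + h2) ^+ 2 *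
  (I_ w ((h1 + h2) * (h1 - g1) / ((h1 - g1) + (h2 - g2))) +
   I_ w ((h1 + h2) * (h2 - g2) / ((h1 - g1) + (h2 - g2)))).

End Modulus.

(* Functions on [a, b] are represented by functions on R; all notions below
   depend only on their restrictions to [a, b]. *)
Section FunctionClasses.
Context {R : realType} {X : lspaceType R} (a b : R).

Definition divided_difference (g1 g2 t : R) (f : R -> X) : X :=
  (g1 + g2)^-1 *s hdiff (f (t + g2)) (f (t - g1)).

Definition is_hderivative (f : R -> X) (t : R) (y : X) : Prop :=
  (t < b ->
    (\forall g \near (0 : R)^'+, hdiff_exists (f (t + g)) (f t)) /\
    g^-1 *s hdiff (f (t + g)) (f t) @[g --> (0 : R)^'+] --> y) /\
  (a < t ->
    (\forall g \near (0 : R)^'+, hdiff_exists (f t) (f (t - g))) /\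
    g^-1 *s hdiff (f t) (f (t - g)) @[g --> (0 : R)^'+] --> y).

(* Value theta if the derivative does not exist. *)
Definition hderivative (t : R) (f : R -> X) : X :=
  xget theta [set y | is_hderivative f t y].

Definition H_class (w : R -> R) : set (R -> X) :=
  [set f | forall s t, s \in `[a, b] -> t \in `[a, b] ->
             mdist (f s) (f t) <= w `|s - t|].

Definition W1H_class (P : X -> X) (w : R -> R) : set (R -> X) :=
  [set f | exists (x : X) (phi : R -> X),
     [/\ convex_elements x, H_class w phi
       & forall s, s \in `[a, b] ->
           exists2 v, is_integral P `[a, s] phi v & f s = x +s v]].

Definition CH_class : set (R -> X) :=
  [set f | {within `[a, b], continuous f} /\
     forall s g1 g2, 0 < g1 -> 0 < g2 -> a <= s - g1 -> s + g2 <= b ->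
       hdiff_exists (f (s + g2)) (f (s - g1))].

Definition normC (f : R -> X) : \bar R :=
  ereal_sup [set (hnorm (f s))%:E | s in `[a, b]].

(* The first clause says that [T] acts on functions on [a, b]. *)
Definition pos_homogeneous_operator (T : (R -> X) -> X) : Prop :=
  (forall f g, CH_class f -> CH_class g ->
     (forall s, s \in `[a, b] -> f s = g s) -> T f = T g) /\
  (forall (k : R) f, CH_class f -> 0 < k -> T (fun s => k *s f s) = k *s T f).

Definition operator_norm (T : (R -> X) -> X) : \bar R :=
  ereal_sup [set (hnorm (T f))%:E | f in
    [set f | CH_class f /\ (normC f <= 1%:E)%E]].

Definition bounded_operator (T : (R -> X) -> X) : Prop :=
  (operator_norm T < +oo)%E.

Definition U_ (P : X -> X) (w : R -> R) (A T : (R -> X) -> X) : \bar R :=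
  ereal_sup [set (mdist (A f) (T f))%:E | f in W1H_class P w].

Definition E_ (P : X -> X) (w : R -> R) (A : (R -> X) -> X) (N : R) : \bar R :=
  ereal_inf [set U_ P w A T | T in
    [set T | [/\ pos_homogeneous_operator T, bounded_operator T
               & (operator_norm T <= N%:E)%E]]].

End FunctionClasses.

(* Main.v *)
Require Import Defs.
From mathcomp Require Import all_boot all_order all_algebra.
From mathcomp Require Import all_classical all_reals all_analysis.
From mathcomp Require Import ring lra.

(* On [W^1 H^omega] both operators are averages of [P phi]: the divided
   difference [Delta_(h1,h2) f] is the mean of [P phi] over [t - h1, t + h2], and
   [D_H f (t) = P (phi t)].  Upper bounds: compare Riemann sums of two such means
   point by point.  For the two divided differences, with [G = g1 + g2],
   [H = h1 + h2], [d_i = h_i - g_i] and [D = d1 + d2], the excess density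
   [1/G - 1/H] on [t - g1, t + g2] is transported to the two outer blocks with
   density [1/H]: the interval is cut at [c] into pieces of length [G d1 / D] and
   [G d2 / D], and each piece is reflected affinely about its outer endpoint onto
   the adjacent block of length [d1], resp. [d2].

   Lower bounds: for [f] in the class,
   [U (A, T) >= |A f| - |T f| >= |A f| - 2 / (h1 + h2) |f|_C].  Take a convex
   invertible [e] of norm 1 and [phi = r e] with a real [r >= 0] vanishing outside
   [t - h1, t + h2]; starting [f] at [- 1/2 (\int r) e] gives [|f|_C = 1/2 \int r],
   so the right-hand side becomes a difference of two means of [r].  It attains the
   upper bound when [r] realizes [omega] along the transport:
   [r s = omega h - omega |s - t|] for the derivative, and two glued copies of
   [v |-> (G/H) omega (H v / G)], [- v |-> - (D/H) omega (H v / D)] ([v >= 0]) for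
   the divided difference.  The latter belongs to [H^omega] because [omega] is
   concave. *)

Set Implicit Arguments.
Unset Strict Implicit.
Unset Printing Implicit Defensive.

Import Order.TTheory GRing.Theory Num.Theory.
Import numFieldNormedType.Exports.

Local Open Scope classical_set_scope.
Local Open Scope ring_scope.

(** * Metric and algebra of L-spaces; convex elements and the operator [P] *)

Section LSpaceTheory.
Context {R : realType} {X : lspaceType R}.
Implicit Types x y z : X.

Lemma slscalex0 (a : R) : a *s (theta : X) = theta.
Proof. by rewrite -[in LHS](slscale0 theta) slscaleA mulr0 slscale0. Qed.

Lemma sladdACA (x y z t : X) : (x +s y) +s (z +s t) = (x +s z) +s (y +s t).
Proof. exact: (Monoid.mulmACA (@sladd R X)). Qed.

Lemma slscale_sum n (k : R) (F : 'I_n -> X) :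
  k *s \big[sladd/theta]_(i < n) F i = \big[sladd/theta]_(i < n) (k *s F i).
Proof.
by apply: (big_morph (slscale k)) => [x y|]; rewrite ?slscaleDr ?slscalex0.
Qed.

Lemma mdist_sladd x y u v : mdist (x +s u) (y +s v) <= mdist x y + mdist u v.
Proof.
apply: le_trans (metric_triangle _ (y +s u) _) _.
by rewrite lerD ?mdist_sladd_le// ![y +s _]sladdC mdist_sladd_le.
Qed.

Lemma mdist_sum_le n (F G : 'I_n -> X) :
  mdist (\big[sladd/theta]_(i < n) F i) (\big[sladd/theta]_(i < n) G i)
    <= \sum_(i < n) mdist (F i) (G i).
Proof.
elim: n F G => [|n IH] F G; first by rewrite !big_ord0 mdistxx.
rewrite !big_ord_recr /=; apply: le_trans (mdist_sladd _ _ _ _) _.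
by rewrite lerD.
Qed.

Lemma convex_theta : convex_elements (theta : X).
Proof. by move=> a b _ _; rewrite !slscalex0 sladdx0. Qed.

Lemma convex_slscale (a : R) x : convex_elements x -> convex_elements (a *s x).
Proof.
move=> cx b c b0 c0; rewrite !slscaleA ![_ * a]mulrC -!slscaleA -slscaleDr.
by rewrite cx.
Qed.

Lemma convex_sum n x (c : 'I_n -> R) : convex_elements x ->
  (forall i, 0 <= c i) ->
  (\sum_(i < n) c i) *s x = \big[sladd/theta]_(i < n) (c i *s x).
Proof.
move=> cx; elim: n c => [|n IH] c c0; first by rewrite !big_ord0 slscale0.
by rewrite !big_ord_recr /= cx ?sumr_ge0// IH.
Qed.

(** Convexity splits the larger multiple, say [a *s x] into [(a - b) *s x +s b *s x], and isotropy
    cancels the common summand. Hence the ray spanned by a convex unit element is an isometric copy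
    of the half-line, which lets real functions serve as extremal ones. *)
Lemma mdist_slscale_convex x (a b : R) : convex_elements x -> isotropic X ->
  0 <= a -> 0 <= b -> mdist (a *s x) (b *s x) = `|a - b| * hnorm x.
Proof.
move=> cx iso; wlog ab : a b / b <= a => [wl|] a0 b0.
  have [/wl->//|/ltW/wl ab] := leP b a.
  by rewrite metric_sym ab// distrC.
rewrite -{1}(subrK b a) cx ?subr_ge0// -{2}(sladd0x (b *s x)) iso.
by rewrite -{1}(slscalex0 (a - b)) mdist_slscale.
Qed.

Lemma hnorm_slscale (a : R) x : hnorm (a *s x) = `|a| * hnorm x.
Proof. by rewrite /hnorm -{1}(slscalex0 a) mdist_slscale. Qed.

Lemma hnorm_ge0 x : 0 <= hnorm x.
Proof. exact: mdist_ge0. Qed.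

Lemma cvg_mdist (u v : nat -> X) x y : u @ \oo --> x -> v @ \oo --> y ->
  mdist (u n) (v n) @[n --> \oo] --> mdist x y.
Proof.
move=> /metricType_numDomainType.cvgrPdist_lt ux.
move=> /metricType_numDomainType.cvgrPdist_lt vy.
 apply/cvgrPdist_le => e e0.
near=> n; rewrite ler_norml.
have : mdist x (u n) < e / 2 by near: n; apply: ux; rewrite divr_gt0.
have : mdist y (v n) < e / 2 by near: n; apply: vy; rewrite divr_gt0.
have := metric_triangle x (u n) y; have := metric_triangle (u n) (v n) y.
have := metric_triangle (u n) x (v n); have := metric_triangle x y (v n).
rewrite (metric_sym (u n) x) (metric_sym (v n) y); lra.
Unshelve. all: by end_near. Qed.

Lemma cvg_mdist0 (u : nat -> X) x (r : nat -> R) :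
  (forall n, mdist (u n) x <= r n) -> r @ \oo --> 0 -> u @ \oo --> x.
Proof.
move=> ur /cvgrPdist_lt r0.
apply/metricType_numDomainType.cvgrPdist_lt => e /r0; apply: filterS => n.
rewrite sub0r normrN metric_sym => rn.
by rewrite (le_lt_trans (ur n))// (le_lt_trans (ler_norm _)).
Qed.

Lemma cvg_mdist_uniq (u : nat -> X) x y :
  u @ \oo --> x -> u @ \oo --> y -> x = y.
Proof. exact: (cvg_unique (@metric_hausdorff _ X)). Qed.

Lemma cvg_slscale (a : R) (u : nat -> X) x :
  u @ \oo --> x -> a *s u n @[n --> \oo] --> a *s x.
Proof.
move=> ux; apply: (@cvg_mdist0 _ _ (fun n => `|a| * mdist (u n) x)).
  by move=> n; rewrite mdist_slscale.
rewrite -[in X in _ --> X](mulr0 `|a|); apply: cvgM; first exact: cvg_cst.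
by rewrite -(mdistxx x); apply: cvg_mdist => //; exact: cvg_cst.
Qed.

Lemma cvg_sladd (u v : nat -> X) x y : u @ \oo --> x -> v @ \oo --> y ->
  u n +s v n @[n --> \oo] --> x +s y.
Proof.
move=> ux vy; apply: (@cvg_mdist0 _ _ (fun n => mdist (u n) x + mdist (v n) y)).
  by move=> n; exact: mdist_sladd.
rewrite -[in X in _ --> X](addr0 0); apply: cvgD.
  by rewrite -(mdistxx x); apply: cvg_mdist => //; exact: cvg_cst.
by rewrite -(mdistxx y); apply: cvg_mdist => //; exact: cvg_cst.
Qed.

Lemma isotropic_cancel x y z : isotropic X -> x +s y = x +s z -> y = z.
Proof.
move=> iso xyz; apply: mdist_positivity.
by rewrite -(iso y z x) ![_ +s x]sladdC xyz mdistxx.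
Qed.

Lemma hdiff_sladd x y : isotropic X -> hdiff (x +s y) x = y.
Proof.
move=> iso; apply: xget_unique => //= z e.
by rewrite (isotropic_cancel iso e).
Qed.

(** Both [(a + b) *s x'] and [a *s x' +s b *s x'] are inverse to [(a + b) *s x], and inverses are
    unique by cancellation. *)
Lemma convex_inverse x x' : isotropic X -> convex_elements x ->
  x +s x' = theta -> convex_elements x'.
Proof.
move=> iso cx xx' a b a0 b0; apply: (@isotropic_cancel ((a + b) *s x)) => //.
rewrite -slscaleDr xx' slscalex0 cx// sladdACA -!slscaleDr xx'.
by rewrite !slscalex0 sladdx0.
Qed.

Variables (P : X -> X) (convP : convexifying_operator P).

Lemma convexifying_convex x : convex_elements (P x).
Proof. by rewrite -(convexifying_surj convP); exists x. Qed.

Lemma convexifying_fix x : convex_elements x -> P x = x.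
Proof.
rewrite -(convexifying_surj convP) => -[y _ <-].
exact: convexifying_idem convP _.
Qed.

Lemma convexifying_scale (a : R) x : P (a *s x) = a *s P x.
Proof.
have := convexifying_lin convP a 0 x x.
by rewrite !slscale0 !sladdx0.
Qed.

Lemma convexifying_add x y : P (x +s y) = P x +s P y.
Proof. by have := convexifying_lin convP 1 1 x y; rewrite !slscale1. Qed.

(** The map [P] fixes every [u n] and is nonexpansive, so the sequence converges to [P x] as well as
    to [x]. *)
Lemma convex_closed (u : nat -> X) x : (forall n, convex_elements (u n)) ->
  u @ \oo --> x -> convex_elements x.
Proof.
move=> cu ux; suff <- : P x = x by exact: convexifying_convex.
apply: (@cvg_mdist_uniq u) => //.
apply: (@cvg_mdist0 _ _ (fun n => mdist (u n) x)).
  by move=> n; rewrite -{1}(convexifying_fix (cu n)); exact: convexifying_lip.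
by rewrite -(mdistxx x); apply: cvg_mdist => //; exact: cvg_cst.
Qed.

Lemma convex_sladd x y : convex_elements x -> convex_elements y ->
  convex_elements (x +s y).
Proof.
move=> /convexifying_fix <- /convexifying_fix <-.
by rewrite -convexifying_add; exact: convexifying_convex.
Qed.

End LSpaceTheory.

(** * Integral of simple mappings *)

Section Volume.
Context {R : realType}.
Implicit Types A B D : set R.

Let mu := @completed_lebesgue_measure R.

Lemma lebesgue_measurableI A B :
  lebesgue_measurable A -> lebesgue_measurable B ->
  lebesgue_measurable (A `&` B).
Proof. exact: measurableI. Qed.

Lemma le_completed_lebesgue_measure A B : A `<=` B -> (mu A <= mu B)%E.
Proof. exact: (le_outer_measure (wlength (R := R) idfun)^*%mu). Qed.

Lemma lebesgue_measurable_itv (i : interval R) :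
  lebesgue_measurable [set` i].
Proof. by apply: sub_caratheodory; exact: measurable_itv. Qed.

Lemma completed_lebesgue_measure_itv_fin (c d : R) : (mu `[c, d] < +oo)%E.
Proof.
have := lebesgue_measure_itv `[c, d] => /= e.
rewrite /mu (_ : completed_lebesgue_measure _ = lebesgue_measure `[c, d])//.
by rewrite e; case: ifP => _; rewrite ?ltry.
Qed.

Lemma completed_lebesgue_measure_itv (c d : R) : c <= d ->
  fine (mu `[c, d]) = d - c.
Proof.
move=> cd; rewrite (_ : mu _ = lebesgue_measure `[c, d])//.
rewrite lebesgue_measure_itv /= lte_fin; case: ltP => [//|dc] /=.
by apply/eqP; rewrite eq_sym subr_eq0 eq_le cd dc.
Qed.

(** Finite additivity transferred to real numbers through [fine]; finiteness of [mu A] passes to all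
    the pieces. *)
Lemma volume_partition n (T : 'I_n -> set R) A :
  lebesgue_measurable A -> (mu A < +oo)%E ->
  (forall i, lebesgue_measurable (T i)) -> trivIset setT T ->
  A `<=` \bigcup_i T i ->
  fine (mu A) = \sum_(i < n) fine (mu (A `&` T i)).
Proof.
move=> mA finA mT tT AT.
have mAT i : lebesgue_measurable (A `&` T i) 
  by exact: lebesgue_measurableI.
have fin i : mu (A `&` T i) \is a fin_num.
  rewrite ge0_fin_numE ?measure_ge0//; apply: le_lt_trans finA.
  by apply: le_completed_lebesgue_measure => x [].
have AE : A = \big[setU/set0]_(i < n) (A `&` T i).
  rewrite -bigcup_seq; apply/seteqP; split => [x Ax|x [i _ []]//].
  by have [i _ Ti] := AT _ Ax; exists i => //=; exact: mem_index_enum.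
rewrite [in LHS]AE /mu measure_semi_additive_ord.
- by rewrite sum_fine.
- exact: mAT.
- apply/trivIsetP => i j _ _ ij; move/trivIsetP : tT => /(_ i j I I ij) Tij.
  by rewrite setIACA Tij setI0.
- by rewrite -AE.
Qed.

End Volume.

Section SimpleIntegral.
Context {R : realType} {X : lspaceType R} (P : X -> X).
Hypothesis convP : convexifying_operator P.
Implicit Types (D : set R) (g : R -> X).

Let mu := @completed_lebesgue_measure R.

(** Both integrals are rewritten over the common refinement by the cells [T1 i] [&] [T2 j]; the
    coefficients may be split because the values of [P] are convex. The comparison is then cell by
    cell, [P] being nonexpansive. *)
Lemma simple_integral_close D g1 g2 v1 v2 (e : R) :
  lebesgue_measurable D -> (mu D < +oo)%E -> 0 <= e ->
  simple_integral P D g1 v1 -> simple_integral P D g2 v2 ->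
  (forall s, D s -> mdist (g1 s) (g2 s) <= e) ->
  mdist v1 v2 <= fine (mu D) * e.
Proof.
move=> mD finD e0 [n1 [T1 [c1 [mT1 tT1 DT1 gc1 ->]]]].
move=> [n2 [T2 [c2 [mT2 tT2 DT2 gc2 ->]]]] ge.
have fin_sub A : lebesgue_measurable A -> A `<=` D -> (mu A < +oo)%E.
  move=> mA AD; apply: le_lt_trans finD.
  exact: le_completed_lebesgue_measure.
have T1D i : T1 i `<=` D by rewrite -DT1 => x Tx; exists i.
have T2D i : T2 i `<=` D by rewrite -DT2 => x Tx; exists i.
have split1 i : fine (mu (T1 i)) = \sum_(j < n2) fine (mu (T1 i `&` T2 j)).
  by apply: volume_partition => //; [exact: fin_sub|rewrite DT2].
have split2 j : fine (mu (T2 j)) = \sum_(i < n1) fine (mu (T2 j `&` T1 i)).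
  by apply: volume_partition => //; [exact: fin_sub|rewrite DT1].
have ge0 A : 0 <= fine (mu A) by rewrite fine_ge0.
rewrite (eq_bigr (fun i => \big[sladd/theta]_(j < n2)
    (fine (mu (T1 i `&` T2 j)) *s P (c1 i)))); last first.
  by move=> i _; rewrite split1 convex_sum//; exact: convexifying_convex convP _.
rewrite [X in mdist _ X](eq_bigr (fun j => \big[sladd/theta]_(i < n1)
    (fine (mu (T2 j `&` T1 i)) *s P (c2 j)))); last first.
  by move=> j _; rewrite split2 convex_sum//; exact: convexifying_convex convP _.
rewrite [X in mdist _ X]exchange_big /=.
apply: le_trans (mdist_sum_le _ _) _.
rewrite (volume_partition mD finD mT1 tT1) ?DT1// mulr_suml.
apply: ler_sum => i _; apply: le_trans (mdist_sum_le _ _) _.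
have DT1i : D `&` T1 i = T1 i by apply/setIidPr.
rewrite DT1i split1 mulr_suml; apply: ler_sum => j _.
rewrite [T2 j `&` _]setIC mdist_slscale ger0_norm//.
(* An empty cell offers no point at which to compare the two values, but it has measure zero. *)
have [->|/set0P[s [T1s T2s]]] := eqVneq (T1 i `&` T2 j) set0.
  by rewrite /mu measure0 !mul0r.
rewrite ler_wpM2l//; apply: le_trans (convexifying_lip convP _ _) _.
by rewrite -(gc1 _ _ T1s) -(gc2 _ _ T2s); apply: ge; exact: (T1D i).
Qed.

Lemma simple_integral_cst D (x : X) : lebesgue_measurable D ->
  simple_integral P D (fun=> x) (fine (mu D) *s P x).
Proof.
move=> mD; exists 1%N, (fun=> D), (fun=> x); split => //.
- by apply/trivIsetP => i j _ _; rewrite !ord1.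
- by apply/seteqP; split => [s [? _]//|s Ds]; exists ord0.
- by rewrite big_ord1.
Qed.

End SimpleIntegral.

Section SimpleIntegralOperations.
Context {R : realType} {X : lspaceType R} (P : X -> X).
Hypothesis convP : convexifying_operator P.
Implicit Types (D : set R) (g : R -> X).

Let mu := @completed_lebesgue_measure R.

Lemma simple_integral_eq D g1 g2 v : (forall s, D s -> g1 s = g2 s) ->
  simple_integral P D g1 v -> simple_integral P D g2 v.
Proof.
move=> g12 [n [T [c [mT tT DT gc ->]]]]; exists n, T, c; split => // i s Tis.
by rewrite -g12 ?(gc i)// -DT; exists i.
Qed.

(** A point is a null set. This makes two adjacent closed segments disjoint before they are
    glued. *)
Lemma simple_integral_setD1 D g v (x : R) :
  simple_integral P D g v -> simple_integral P (D `\ x) g v.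
Proof.
move=> [n [T [c [mT tT DT gc ->]]]]; exists n, (fun i => T i `\ x), c.
have m1 : lebesgue_measurable [set x].
  by apply: sub_caratheodory; exact: measurable_set1.
have mu1 : mu [set x] = 0%E.
  by rewrite (_ : mu _ = lebesgue_measure [set x])// lebesgue_measure_set1.
split.
- by move=> i; exact: (measurableD (mT i) m1).
- apply/trivIsetP => i j _ _ ij; move/trivIsetP : tT => /(_ i j I I ij) Tij.
  by rewrite setDE setDE setIACA Tij set0I.
- by rewrite -DT setD_bigcupl.
- by move=> i s [Tis _]; exact: gc.
- apply: eq_bigr => i _; congr (fine _ *s _).
  rewrite (measureDI mu (mT i) m1).
  rewrite [X in (_ + X)%E](_ : _ = 0%E) ?adde0//.
  apply/eqP; rewrite eq_le measure_ge0 andbT -mu1.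
  by apply: le_completed_lebesgue_measure => s [].
Qed.

Lemma simple_integral_setU D1 D2 g v1 v2 : D1 `&` D2 = set0 ->
  simple_integral P D1 g v1 -> simple_integral P D2 g v2 ->
  simple_integral P (D1 `|` D2) g (v1 +s v2).
Proof.
move=> D12 [n1 [T1 [c1 [mT1 tT1 DT1 gc1 ->]]]].
move=> [n2 [T2 [c2 [mT2 tT2 DT2 gc2 ->]]]].
pose T (k : 'I_(n1 + n2)) :=
  match fintype.split k with inl i => T1 i | inr j => T2 j end.
pose c (k : 'I_(n1 + n2)) :=
  match fintype.split k with inl i => c1 i | inr j => c2 j end.
have Tl i : T (lshift n2 i) = T1 i by rewrite /T (unsplitK (inl i)).
have Tr j : T (rshift n1 j) = T2 j by rewrite /T (unsplitK (inr j)).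
have cl i : c (lshift n2 i) = c1 i by rewrite /c (unsplitK (inl i)).
have cr j : c (rshift n1 j) = c2 j by rewrite /c (unsplitK (inr j)).
exists (n1 + n2)%N, T, c; split.
- by move=> k; rewrite /T; case: fintype.split.
- move=> k l _ _ [s []]; case: (split_ordP k) => i ->; case: (split_ordP l) => j ->;
    rewrite ?Tl ?Tr.
  + by move=> Ti Tj; rewrite (tT1 i j)//; exists s.
  + move=> Ti Tj; suff : (D1 `&` D2) s by rewrite D12.
    by rewrite -DT1 -DT2; split; [exists i|exists j].
  + move=> Ti Tj; suff : (D1 `&` D2) s by rewrite D12.
    by rewrite -DT1 -DT2; split; [exists j|exists i].
  + by move=> Ti Tj; rewrite (tT2 i j)//; exists s.
- apply/seteqP; split => [s [k _]|s].
    rewrite -DT1 -DT2; case: (split_ordP k) => i ->; rewrite ?Tl ?Tr => Ts.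
      by left; exists i.
    by right; exists i.
  rewrite -DT1 -DT2 => -[[i _ Ts]|[i _ Ts]].
    by exists (lshift n2 i); rewrite ?Tl.
  by exists (rshift n1 i); rewrite ?Tr.
- move=> k s; case: (split_ordP k) => i ->; rewrite ?Tl ?Tr ?cl ?cr.
    exact: gc1.
  exact: gc2.
- rewrite big_split_ord /=; congr (_ +s _); apply: eq_bigr => i _.
    by rewrite Tl cl.
  by rewrite Tr cr.
Qed.

Lemma uniform_cvgP D (g : nat -> R -> X) (f : R -> X) :
  {uniform D, g @ \oo --> f} <->
  forall e, 0 < e -> \forall n \near \oo, forall s, D s -> mdist (f s) (g n s) < e.
Proof.
split => [gf e e0|gf].
  apply: (gf [set h | forall s, D s -> mdist (f s) (h s) < e]).
  apply/uniform_nbhs; exists [set xy | ball xy.1 e xy.2]; split.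
    exact: entourage_ball (PosNum e0).
  by move=> h /= fh s Ds; have := fh s Ds; rewrite ballEmdist.
move=> A /uniform_nbhs[E [/= entE EA]].
move: entE; rewrite -entourage_ballE => -[e /= e0 eE].
apply: filterS (gf e e0) => n gn; apply: EA => s Ds; apply: eE => /=.
by rewrite ballEmdist; exact: gn.
Qed.

End SimpleIntegralOperations.

(** * Uniform limits of simple mappings: uniqueness, additivity and existence of the integral *)

Section IntegralTheory.
Context {R : realType} {X : lspaceType R} (P : X -> X).
Hypothesis convP : convexifying_operator P.
Implicit Types (D : set R) (f g : R -> X).

Let mu := @completed_lebesgue_measure R.

(** Provides the accuracy [d] at which two mappings on a set of measure [m] are approximated;
    dividing by [m + 1] covers [m = 0]. *)
Lemma exists_small_factor (m e : R) : 0 <= m -> 0 < e ->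
  exists2 d, 0 < d & m * (2 * d) < e.
Proof.
move=> m0 e0; have m1 : 0 < m + 1 by rewrite ltr_wpDl.
exists (e / (2 * (m + 1))); first by rewrite divr_gt0// mulr_gt0.
have -> : m * (2 * (e / (2 * (m + 1)))) = e * m / (m + 1) by field; lra.
by rewrite ltr_pdivrMr// ltr_pM2l// ltrDl.
Qed.

(** Simple mappings within [d] of [f1] and [f2] are within [e + 2 * d] of each other; the estimate
    for simple mappings passes to the limit, and [d] is arbitrary. *)
Lemma is_integral_close D f1 f2 v1 v2 (e : R) :
  lebesgue_measurable D -> (mu D < +oo)%E -> 0 <= e ->
  is_integral P D f1 v1 -> is_integral P D f2 v2 ->
  (forall s, D s -> mdist (f1 s) (f2 s) <= e) ->
  mdist v1 v2 <= fine (mu D) * e.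
Proof.
move=> mD finD e0 [g1 [w1 [sg1 /uniform_cvgP gf1 wv1]]].
move=> [g2 [w2 [sg2 /uniform_cvgP gf2 wv2]]] fe.
have mu0 : 0 <= fine (mu D) by rewrite fine_ge0.
apply/ler_addgt0Pr => eta eta0.
have [d d0 md] := exists_small_factor mu0 eta0.
have : mdist v1 v2 <= fine (mu D) * (e + 2 * d).
  apply: (ler_cvg_to (cvg_mdist wv1 wv2) (cvg_cst _)).
  near=> n; apply: (simple_integral_close convP mD finD _ (sg1 n) (sg2 n)).
    by rewrite addr_ge0// mulr_ge0// ltW.
  have g1n : forall s, D s -> mdist (f1 s) (g1 n s) < d by near: n; exact: gf1.
  have g2n : forall s, D s -> mdist (f2 s) (g2 n s) < d by near: n; exact: gf2.
  move=> s Ds; have := g1n _ Ds; have := g2n _ Ds.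
  have := metric_triangle (g1 n s) (f1 s) (g2 n s).
  have := metric_triangle (f1 s) (f2 s) (g2 n s).
  have := fe _ Ds; rewrite (metric_sym (g1 n s) (f1 s)); lra.
by move/le_trans; apply; rewrite mulrDr lerD2l ltW.
Unshelve. all: by end_near. Qed.

Lemma is_integral_cst D (x : X) : lebesgue_measurable D ->
  is_integral P D (fun=> x) (fine (mu D) *s P x).
Proof.
move=> mD; exists (fun _ _ => x), (fun=> fine (mu D) *s P x); split.
- by move=> _; exact: simple_integral_cst.
- by apply/uniform_cvgP => e e0; near=> n => s _; rewrite mdistxx.
- exact: cvg_cst.
Unshelve. all: by end_near. Qed.

Lemma is_integral_unique D f v1 v2 :
  lebesgue_measurable D -> (mu D < +oo)%E ->
  is_integral P D f v1 -> is_integral P D f v2 -> v1 = v2.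
Proof.
move=> mD finD f1 f2; apply: mdist_positivity; apply/eqP.
rewrite eq_le mdist_ge0 andbT -(mulr0 (fine (mu D))).
by apply: (is_integral_close mD finD _ f1 f2) => // s _; rewrite mdistxx.
Qed.

Lemma is_integral_convex D f v : is_integral P D f v -> convex_elements v.
Proof.
move=> [g [w [sg _ wv]]]; apply: (convex_closed convP) wv => n.
have [m [T [c [_ _ _ _ ->]]]] := sg n.
apply: (big_ind convex_elements); first exact: convex_theta.
  exact: convex_sladd convP.
by move=> i _; apply: convex_slscale; exact: convexifying_convex convP _.
Qed.

(** The approximants of the two pieces are glued at [d], and the point [d] is assigned to the left
    piece. *)
Lemma is_integral_cat f (c d e : R) v1 v2 : c <= d -> d <= e ->
  is_integral P `[c, d] f v1 -> is_integral P `[d, e] f v2 ->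
  is_integral P `[c, e] f (v1 +s v2).
Proof.
move=> cd de [g1 [w1 [sg1 /uniform_cvgP gf1 wv1]]].
move=> [g2 [w2 [sg2 /uniform_cvgP gf2 wv2]]].
exists (fun n s => if s <= d then g1 n s else g2 n s), (fun n => w1 n +s w2 n).
have ceE : `[c, e]%classic = `[c, d]%classic `|` (`[d, e]%classic `\ d).
  apply/seteqP; split => s /=; rewrite !in_itv /=.
    move=> /andP[cs se].
    have [sd|ds] := leP s d; first by left; rewrite cs.
    by right; split; [rewrite (ltW ds)|move=> sd; rewrite sd ltxx in ds].
  by move=> [/andP[-> /le_trans->//]|[/andP[/(le_trans cd)-> ->]]].
split.
- move=> n; rewrite ceE; apply: simple_integral_setU.
  + apply/seteqP; split => s //= []; rewrite !in_itv /= => /andP[_ sd].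
    by move=> [/andP[ds _]]; apply; apply/eqP; rewrite eq_le sd ds.
  + apply: simple_integral_eq (sg1 n) => s.
    by rewrite /= in_itv /= => /andP[_ ->].
  + apply: simple_integral_eq (simple_integral_setD1 d (sg2 n)) => s.
    rewrite /= in_itv /= => -[/andP[ds _] sd]; case: leP => // sd'.
    by case: sd; apply/eqP; rewrite eq_le sd' ds.
- apply/uniform_cvgP => eta eta0; near=> n.
  have g1n : forall s, s \in `[c, d] -> mdist (f s) (g1 n s) < eta.
    by near: n; exact: gf1.
  have g2n : forall s, s \in `[d, e] -> mdist (f s) (g2 n s) < eta.
    by near: n; exact: gf2.
  move=> s /=; rewrite in_itv /= => /andP[cs se]; have [sd|ds] := leP s d.
    by apply: g1n; rewrite in_itv /= cs.
  by apply: g2n; rewrite in_itv /= (ltW ds).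
- exact: cvg_sladd.
Unshelve. all: by end_near. Qed.

(** Approximants within [d] of [f] are within [2 * d] of each other, so their integrals form a
    Cauchy sequence in a complete space. *)
Lemma uniform_cvg_is_integral D f (g : nat -> R -> X) (w : nat -> X) :
  lebesgue_measurable D -> (mu D < +oo)%E ->
  (forall n, simple_integral P D (g n) (w n)) -> {uniform D, g @ \oo --> f} ->
  exists v, is_integral P D f v.
Proof.
move=> mD finD sg gf; have /uniform_cvgP gf' := gf.
suff /cauchy_cvg : cauchy (w @ \oo) by move=> wv; exists (lim (w @ \oo)), g, w.
apply/cauchyP => e e0.
have mu0 : 0 <= fine (mu D) by rewrite fine_ge0.
have [d d0 md] := exists_small_factor mu0 e0.
have [N _ gN] := gf' d d0.
exists (w N); exists N => // n /= Nn; rewrite ballEmdist /=.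
apply: le_lt_trans md.
apply: (simple_integral_close convP mD finD _ (sg N) (sg n)).
    by rewrite mulr_ge0// ltW.
  move=> s Ds; have := gN N (leqnn N) s Ds; have := gN n Nn s Ds.
  have := metric_triangle (g N s) (f s) (g n s).
  rewrite (metric_sym (g N s) (f s)); lra.
Qed.

(** On each grid cell [phi] is frozen at the left end; the truncated quotient is the number of the
    cell containing [s]. *)
Lemma simple_integral_step (c d delta : R) (phi : R -> X) : c <= d ->
  0 < delta -> exists v, simple_integral P `[c, d]
    (fun s => phi (c + delta * (Num.truncn ((s - c) / delta))%:R)) v.
Proof.
(* The successor adds the last, possibly incomplete, cell, the one containing [d]. *)
move=> cd d0; pose N := (Num.truncn ((d - c) / delta)).+1.
pose T (i : 'I_N) :=
  `[c, d]%classic `&` `[c + delta * i%:R, c + delta * i.+1%:R[%classic.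
eexists; exists N, T, (fun i => phi (c + delta * i%:R)); split; last by [].
- by move=> i; apply: lebesgue_measurableI; exact: lebesgue_measurable_itv.
- move=> i j _ _ [s []] [_ +] [_ +]; rewrite /= !in_itv /= => si sj.
  have H (k : 'I_N) : c + delta * k%:R <= s < c + delta * k.+1%:R ->
     Num.truncn ((s - c) / delta) = k.
    move=> /andP[sk1 sk2]; apply: truncn_def; apply/andP; split.
      by rewrite ler_pdivlMr// mulrC lerBrDl.
    by rewrite ltr_pdivrMr// mulrC ltrBlDl.
  by apply: val_inj; rewrite /= -(H _ si) (H _ sj).
- apply/seteqP; split => [s [i _ []//]|s cds].
  have /andP[cs sd] : c <= s <= d by move: cds; rewrite /= in_itv.
  have sN : (Num.truncn ((s - c) / delta) < N)%N.
    by rewrite ltnS le_truncn// ler_pM2r ?invr_gt0// lerB.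
  exists (Ordinal sN) => //; split => //; rewrite /= in_itv /=.
  have : 0 <= (s - c) / delta by rewrite divr_ge0 ?subr_ge0// ltW.
  move=> /truncn_itv/andP[]; rewrite ler_pdivlMr// ltr_pdivrMr// => H1 H2.
  by rewrite -lerBrDl -ltrBlDl ![delta * _]mulrC H1.
- move=> i s [_]; rewrite /= in_itv /= => /andP[sk1 sk2].
  congr (phi (c + delta * _%:R)); apply: truncn_def; apply/andP; split.
    by rewrite ler_pdivlMr// mulrC lerBrDl.
  by rewrite ltr_pdivrMr// mulrC ltrBlDl.
Qed.

Lemma modulus_near0 (w : R -> R) (e : R) : modulus_of_continuity w -> 0 < e ->
  exists2 d, 0 < d & forall s, 0 <= s -> s <= d -> w s < e.
Proof.
move=> mw e0; have /subspace_continuousP := modulus_continuous mw.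
move=> /(_ 0); rewrite /= in_itv /= lexx => /(_ isT).
move=> /cvgrPdist_lt /(_ e e0) /nbhs_ballP[d /= d0 H].
exists (d / 2) => [|s s0 sd]; first by rewrite divr_gt0.
have : `|w 0 - w s| < e.
  apply: H; last by rewrite /= in_itv /= andbT.
  by rewrite /ball /= sub0r normrN ger0_norm//; lra.
by rewrite (modulus0 mw) sub0r normrN ger0_norm// modulus_ge0.
Qed.

(** Each point is within one mesh of its grid point, so the step mappings of mesh [n.+1%:R^-1]
    converge to [phi] uniformly at a rate controlled by [w]. *)
Lemma is_integral_exists (w : R -> R) (c d : R) (phi : R -> X) : c <= d ->
  modulus_of_continuity w -> H_class c d w phi ->
  exists v, is_integral P `[c, d] phi v.
Proof.
move=> cd mw Hphi.
pose g n s := phi (c + n.+1%:R^-1 * (Num.truncn ((s - c) / n.+1%:R^-1))%:R).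
have n0 n : 0 < n.+1%:R^-1 :> R by rewrite invr_gt0.
have sg n : exists v, simple_integral P `[c, d] (g n) v.
  exact: simple_integral_step.
have mD := lebesgue_measurable_itv `[c, d].
have finD := completed_lebesgue_measure_itv_fin c d.
apply: (uniform_cvg_is_integral mD finD (fun n => projT2 (cid (sg n)))).
apply/uniform_cvgP => e e0; have [r r0 wr] := modulus_near0 mw e0.
near=> n => s; rewrite /= in_itv /= => /andP[cs sd].
have nr : n.+1%:R^-1 < r by near: n; exact: near_infty_natSinv_lt (PosNum r0).
have : 0 <= (s - c) / n.+1%:R^-1 by rewrite divr_ge0 ?subr_ge0// ltW.
move=> /truncn_itv/andP[]; rewrite ler_pdivlMr// ltr_pdivrMr//.
rewrite /g; set k := Num.truncn _; rewrite -[k.+1]addn1 natrD mulrDl mul1r => H1 H2.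
have k0 : 0 <= k%:R * n.+1%:R^-1 :> R by rewrite mulr_ge0// ltW.
rewrite [_^-1 * _]mulrC; move: n.+1%:R^-1 H1 H2 k0 nr => q.
move: (k%:R * q) => x H1 H2 k0 nr.
apply: le_lt_trans (Hphi _ _ _ _) _; rewrite ?in_itv /= ?cs ?sd//.
  by apply/andP; split; lra.
rewrite ger0_norm; first by apply: wr; lra.
lra.
Unshelve. all: by end_near. Qed.

End IntegralTheory.

(** * Riemann sums of the modulus of continuity *)

Section ModulusIntegral.
Context {R : realType} (w : R -> R).
Hypothesis mw : modulus_of_continuity w.

Let mu := @lebesgue_measure R.

Lemma modulus_integrable (x y : R) : 0 <= x ->
  mu.-integrable `[x, y] (EFin \o w).
Proof.
move=> x0; apply: continuous_compact_integrable; first exact: segment_compact.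
apply: continuous_subspaceW (modulus_continuous mw).
by move=> s /=; rewrite !in_itv /= andbT => /andP[/(le_trans x0)].
Qed.

Lemma modulus_integral_cst (x y c : R) : x <= y ->
  \int[mu]_(s in `[x, y]) (fun=> c) s = (y - x) * c.
Proof.
move=> xy; rewrite Rintegral_cst//.
rewrite mulrC; congr (_ * _).
rewrite [X in fine X](lebesgue_measure_itv `[x, y]) /= lte_fin.
by case: ltP => [//|yx] /=; apply/eqP; rewrite eq_sym subr_eq0 eq_le xy yx.
Qed.

Lemma I_sub_bounds (x y : R) : 0 <= x -> x <= y ->
  (y - x) * w x <= I_ w y - I_ w x <= (y - x) * w y.
Proof.
move=> x0 xy.
have icst c : mu.-integrable `[x, y] (EFin \o (fun=> c)).
  apply: continuous_compact_integrable; first exact: segment_compact.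
  by apply: continuous_subspaceT => ?; exact: cst_continuous.
have -> : I_ w y - I_ w x = \int[mu]_(s in `[x, y]) w s.
  rewrite /I_ Rintegral_itvB ?bnd_simp//; last exact: modulus_integrable.
  rewrite Rintegral_itv_obnd_cbnd//.
  apply: integrableS (modulus_integrable y x0) => //.
  by move=> s /=; rewrite !in_itv /= => /andP[/ltW ->].
rewrite -!modulus_integral_cst//; apply/andP; split; apply: le_Rintegral => //;
  try exact: modulus_integrable.
- by move=> s /=; rewrite in_itv /= => /andP[xs sy]; exact: modulus_nondecreasing.
- move=> s /=; rewrite in_itv /= => /andP[xs sy].
  by apply: modulus_nondecreasing => //; exact: le_trans xs.
Qed.

Lemma I_0 : I_ w 0 = 0.
Proof. by rewrite /I_ set_itv1 Rintegral_set1. Qed.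

(** Left Riemann sum for the mean of [w] over [[0, M]], with the same weights and parameters as the
    means of mappings defined below, so that the two compare term by term. *)
Definition modulus_mean (M : R) (n : nat) : R :=
  \sum_(i < n.+1) n.+1%:R^-1 * w (M * (i%:R / n.+1%:R)).

(** As [w] is non-decreasing, left tags give a lower sum and right tags an upper one; their
    difference telescopes to [M * w M / n.+1%:R] because [w 0 = 0]. *)
Lemma modulus_mean_bounds (M : R) n : 0 <= M ->
  M * modulus_mean M n <= I_ w M <= M * modulus_mean M n + M * w M / n.+1%:R.
Proof.
move=> M0; pose x (i : nat) := M * (i%:R / n.+1%:R).
have n0 : n.+1%:R != 0 :> R by rewrite pnatr_eq0.
have x0 i : 0 <= x i by rewrite /x mulr_ge0// divr_ge0.
have xS i : x i.+1 - x i = M / n.+1%:R.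
  by rewrite /x -[i.+1]addn1 natrD; field.
have xSle i : x i <= x i.+1 by rewrite -subr_ge0 xS divr_ge0.
have IE : I_ w M = \sum_(0 <= i < n.+1) (I_ w (x i.+1) - I_ w (x i)).
  by rewrite telescope_sumr// /x divff// mulr1 mul0r mulr0 I_0 subr0.
have sumE : M * modulus_mean M n = \sum_(0 <= i < n.+1) (M / n.+1%:R * w (x i)).
  by rewrite big_mkord mulr_sumr; apply: eq_bigr => i _; rewrite mulrA.
rewrite IE sumE; apply/andP; split.
  apply: ler_sum => i _; rewrite -(xS i).
  by have /andP[] := I_sub_bounds (x0 i) (xSle i).
have -> : M * w M / n.+1%:R =
    \sum_(0 <= i < n.+1) (M / n.+1%:R * w (x i.+1) - M / n.+1%:R * w (x i)).
  rewrite telescope_sumr// /x divff// mulr1 mul0r mulr0 (modulus0 mw) mulr0.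
  by rewrite subr0 mulrAC.
rewrite -big_split /=; apply: ler_sum => i _.
rewrite addrC subrK -(xS i).
by have /andP[] := I_sub_bounds (x0 i) (xSle i).
Qed.

Lemma cvg_invn (c : R) : c / n.+1%:R @[n --> \oo] --> (0 : R).
Proof.
rewrite -[in X in _ --> X](mulr0 c); apply: cvgM; first exact: cvg_cst.
exact: cvg_harmonic.
Qed.

Lemma cvg_modulus_mean (M : R) : 0 <= M ->
  modulus_mean M @ \oo --> I_ w M / M.
Proof.
(* For [M = 0] the quotient is 0 by the convention on inverses, which agrees with the sums, all
   equal to [w 0 = 0]. *)
move=> M0; have [->|Mneq] := eqVneq M 0.
  rewrite invr0 mulr0 (_ : modulus_mean 0 = fun=> 0); first exact: cvg_cst.
  apply/funext => n; rewrite /modulus_mean big1// => i _.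
  by rewrite mul0r (modulus0 mw) mulr0.
have Mgt0 : 0 < M by rewrite lt_neqAle eq_sym Mneq.
apply: (@squeeze_cvgr _ _ _ _ (fun n => I_ w M / M - w M / n.+1%:R)
  (fun=> I_ w M / M) (modulus_mean M)); last 2 first.
- rewrite -[in X in _ --> X](subr0 (I_ w M / M)); apply: cvgB.
    exact: cvg_cst.
  exact: cvg_invn.
- exact: cvg_cst.
near=> n; have /andP[H1 H2] := modulus_mean_bounds n M0.
rewrite ler_pdivlMr// [_ * M]mulrC H1 andbT lerBlDr ler_pdivrMr//.
apply: le_trans H2 _; rewrite [leRHS]
  (_ : _ = M * modulus_mean M n + M * w M / n.+1%:R)//.
ring.
Unshelve. all: by end_near. Qed.

(** Cost of transporting one block: the excess density [G^-1 - (G + D)^-1] on a piece of length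
    [G * d / D] is moved onto a block of length [d]. The right-hand side is one of the two summands
    of [K_]. *)
Lemma block_constant (G D d : R) : 0 < G -> 0 < D ->
  (G^-1 - (G + D)^-1) * (G * d / D) * (I_ w (G * d / D + d) / (G * d / D + d))
  = D / (G + D) ^+ 2 * I_ w ((G + D) * d / D).
Proof.
move=> G0 D0; have H0 : 0 < G + D by rewrite addr_gt0.
have -> : G * d / D + d = (G + D) * d / D by field; rewrite lt0r_neq0.
have [->|dn] := eqVneq d 0; first by rewrite !(mulr0, mul0r) I_0 mulr0.
by field; rewrite dn !lt0r_neq0.
Qed.

(** By semi-additivity [w] has itself as a modulus of continuity. *)
Lemma modulus_dist (x y : R) : 0 <= x -> 0 <= y -> `|w x - w y| <= w `|x - y|.
Proof.
wlog xy : x y / x <= y => [wl x0 y0|x0 y0].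
  have [xy|/ltW yx] := leP x y; first exact: wl.
  by rewrite distrC [`|x - y|]distrC wl.
rewrite distrC [`|x - y|]distrC !ger0_norm ?subr_ge0//.
  rewrite lerBlDr -{1}(subrK x y).
  by apply: (modulus_semiadditive mw) => //; rewrite subr_ge0.
exact: modulus_nondecreasing.
Qed.

End ModulusIntegral.

(** * Riemann sums in L-spaces *)

Section IntegralMeans.
Context {R : realType} {X : lspaceType R} (P : X -> X).

(* The integral of [phi] over [c, d]; [theta] if it does not exist. *)
Definition lint (phi : R -> X) (c d : R) : X :=
  xget theta [set v | is_integral P `[c, d] phi v].

(* Mean of [P phi] over the segment from [p] to [p + A], for [A] of any sign:
   tags run away from [p]. *)
Definition rmean (phi : R -> X) (p A : R) (n : nat) : X :=
  \big[sladd/theta]_(i < n.+1)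
    (n.+1%:R^-1 *s P (phi (p + A * (i%:R / n.+1%:R)))).

Hypothesis convP : convexifying_operator P.
Variables (a b : R) (w : R -> R) (phi : R -> X).
Hypothesis mw : modulus_of_continuity w.
Hypothesis Hphi : H_class a b w phi.

Lemma H_class_le s t : a <= s <= b -> a <= t <= b ->
  mdist (phi s) (phi t) <= w `|s - t|.
Proof. by move=> s_ t_; apply: Hphi; rewrite in_itv. Qed.

Lemma lint_unique c d v : is_integral P `[c, d] phi v -> lint phi c d = v.
Proof.
move=> iv; apply: xget_unique => //= u iu.
by apply: is_integral_unique iu iv => //; [exact: lebesgue_measurable_itv|
  exact: completed_lebesgue_measure_itv_fin].
Qed.

Lemma lintP c d : a <= c -> c <= d -> d <= b ->
  is_integral P `[c, d] phi (lint phi c d).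
Proof.
move=> ac cd db.
have [v iv] : exists v, is_integral P `[c, d] phi v.
  apply: (is_integral_exists convP cd mw) => s t.
  rewrite !in_itv /= => /andP[cs sd] /andP[ct td]; apply: Hphi;
    by rewrite in_itv /=; apply/andP; split; lra.
by rewrite (lint_unique iv).
Qed.

Lemma lint_cat c d e : a <= c -> c <= d -> d <= e -> e <= b ->
  lint phi c e = lint phi c d +s lint phi d e.
Proof.
move=> ac cd de eb; apply: lint_unique.
have H1 : is_integral P `[c, d] phi (lint phi c d) by apply: lintP => //; lra.
have H2 : is_integral P `[d, e] phi (lint phi d e) by apply: lintP => //; lra.
exact: (is_integral_cat cd de H1 H2).
Qed.

Lemma lint_convex c d : a <= c -> c <= d -> d <= b ->
  convex_elements (lint phi c d).
Proof. by move=> ac cd db; exact: (is_integral_convex convP (lintP ac cd db)). Qed.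

(** Comparison with the constant mapping [x], whose integral is [(d - c) *s P x]. *)
Lemma lint_near_cst c d (x : X) (e : R) : a <= c -> c <= d -> d <= b ->
  0 <= e -> (forall s, c <= s <= d -> mdist (phi s) x <= e) ->
  mdist (lint phi c d) ((d - c) *s P x) <= (d - c) * e.
Proof.
move=> ac cd db e0 H.
rewrite -(completed_lebesgue_measure_itv cd).
have mD := lebesgue_measurable_itv `[c, d].
apply: (is_integral_close convP mD _ e0 (lintP ac cd db) (is_integral_cst P x mD)).
  exact: completed_lebesgue_measure_itv_fin.
by move=> s; rewrite /= in_itv; exact: H.
Qed.

Lemma lint_bound c d (e : R) : a <= c -> c <= d -> d <= b ->
  0 <= e -> (forall s, c <= s <= d -> hnorm (phi s) <= e) ->
  hnorm (lint phi c d) <= (d - c) * e.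
Proof.
move=> ac cd db e0 H; have := lint_near_cst ac cd db e0 H.
by rewrite (convexifying_fix convP (@convex_theta _ _)) slscalex0.
Qed.

Lemma lintxx c : a <= c <= b -> lint phi c c = theta.
Proof.
move=> /andP[ac cb]; apply: mdist_positivity; apply/eqP.
rewrite eq_le mdist_ge0 andbT.
have -> : theta = (c - c) *s P (phi c) by rewrite subrr slscale0.
apply: le_trans (lint_near_cst ac _ cb (lexx 0) _) _ => //.
  by move=> s /le_anti <-; rewrite mdistxx.
by rewrite subrr mul0r.
Qed.

(** Each cell contributes an error of at most [delta * w delta]. The tags are arbitrary within their
    cells, so left and right Riemann sums are treated alike. *)
Lemma lint_cells n (delta c : R) (x : nat -> R) : 0 <= delta -> a <= c ->
  c + delta * n%:R <= b ->
  (forall i, (i < n)%N -> c + delta * i%:R <= x i <= c + delta * i.+1%:R) ->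
  mdist (lint phi c (c + delta * n%:R))
        (\big[sladd/theta]_(i < n) (delta *s P (phi (x i))))
    <= delta * n%:R * w delta.
Proof.
move=> d0 ac; elim: n => [|n IH] cb xi.
  by rewrite big_ord0 mulr0 addr0 lintxx ?mdistxx ?mul0r//; lra.
have nS : n.+1%:R = n%:R + 1 :> R by rewrite -natr1.
have n0 : 0 <= delta * n%:R by rewrite mulr_ge0.
move: cb; rewrite nS mulrDr mulr1 addrA => cb.
rewrite big_ord_recr /= (@lint_cat c (c + delta * n%:R)) ?lerDl//.
apply: le_trans (mdist_sladd _ _ _ _) _; rewrite mulrDl lerD//.
  apply: IH; first lra.
  by move=> i iltn; apply: xi; exact: ltnW.
have := xi n (leqnn _); rewrite nS mulrDr mulr1 addrA => /andP[xn1 xn2].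
set e := c + delta * n%:R in cb xn1 xn2 *.
have {2 3}-> : delta = (e + delta) - e by ring.
have ae : a <= e by rewrite /e; lra.
apply: lint_near_cst => //; [by rewrite lerDl|exact: modulus_ge0|].
move=> s /andP[es se]; apply: le_trans (H_class_le _ _) _; [lra|lra|].
apply: (modulus_nondecreasing mw) => //; rewrite ler_norml; lra.
Qed.

Lemma cvg_modulus_small (A : R) : 0 <= A -> w (A / n.+1%:R) @[n --> \oo] --> 0.
Proof.
move=> A0; apply/cvgrPdist_lt => e e0; have [r r0 wr] := modulus_near0 mw e0.
near=> n; have An : A / n.+1%:R < r.
  by near: n; exact: (cvgr_lt _ (cvg_invn A)).
have An0 : 0 <= A / n.+1%:R by rewrite divr_ge0.
by rewrite sub0r normrN ger0_norm ?(modulus_ge0 mw)//; apply: wr => //; exact: ltW.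
Unshelve. all: by end_near. Qed.

Lemma cvg_rmean_r (p A : R) : 0 <= A -> a <= p -> p + A <= b ->
  A *s rmean phi p A n @[n --> \oo] --> lint phi p (p + A).
Proof.
move=> A0 ap pb; apply: (@cvg_mdist0 _ _ _ _ (fun n => A * w (A / n.+1%:R))).
  move=> n; rewrite metric_sym.
  have n0 : n.+1%:R != 0 :> R by rewrite pnatr_eq0.
  have pE : p + A = p + A / n.+1%:R * n.+1%:R by rewrite divfK.
  rewrite (_ : A *s _ = \big[sladd/theta]_(i < n.+1) ((A / n.+1%:R) *s
      P (phi (p + A / n.+1%:R * i%:R)))); last first.
    rewrite slscale_sum; apply: eq_bigr => i _; rewrite slscaleA.
    by rewrite mulrAC mulrA.
  rewrite [X in lint _ _ X]pE.
  have -> : A * w (A / n.+1%:R) = A / n.+1%:R * n.+1%:R * w (A / n.+1%:R).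
    by rewrite divfK.
  apply: (@lint_cells n.+1 _ _ (fun i => p + A / n.+1%:R * i%:R)) => //.
  - by rewrite divr_ge0.
  - by rewrite -pE.
  - move=> i _; rewrite lexx lerD2l ler_wpM2l ?divr_ge0//.
    by rewrite ler_nat.
rewrite -[in X in _ --> X](mulr0 A); apply: cvgM; first exact: cvg_cst.
exact: cvg_modulus_small.
Qed.

Lemma cvg_rmean_l (p A : R) : 0 <= A -> a <= p - A -> p <= b ->
  A *s rmean phi p (- A) n @[n --> \oo] --> lint phi (p - A) p.
Proof.
move=> A0 ap pb; apply: (@cvg_mdist0 _ _ _ _ (fun n => A * w (A / n.+1%:R))).
  move=> n; rewrite metric_sym.
  have n0 : n.+1%:R != 0 :> R by rewrite pnatr_eq0.
  pose q := p - A; have pE : p = q + A / n.+1%:R * n.+1%:R.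
    by rewrite divfK// /q subrK.
  rewrite (_ : A *s _ = \big[sladd/theta]_(i < n.+1) ((A / n.+1%:R) *s
      P (phi (q + A / n.+1%:R * i.+1%:R)))); last first.
    (* Tags running leftwards from [p] become, in reverse order, the right ends of the cells counted
       from [q]. *)
    rewrite slscale_sum (reindex_inj rev_ord_inj) /=.
    apply: eq_bigr => i _; rewrite slscaleA.
    have ii : (i <= n)%N by rewrite -ltnS.
    have nE : n%:R = (n - i)%:R + i%:R :> R by rewrite -natrD subnK.
    congr (_ *s P (phi _)); rewrite subSS pE -[i.+1%:R]natr1 -[n.+1%:R]natr1 nE.
    by field; rewrite -nE natr1 pnatr_eq0.
  rewrite [X in lint _ _ X]pE -/q.
  have -> : A * w (A / n.+1%:R) = A / n.+1%:R * n.+1%:R * w (A / n.+1%:R).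
    by rewrite divfK.
  apply: (@lint_cells n.+1 _ _ (fun i => q + A / n.+1%:R * i.+1%:R)) => //.
  - by rewrite divr_ge0.
  - by rewrite -pE.
  - move=> i _; rewrite lexx lerD2l ler_wpM2l ?divr_ge0//.
    by rewrite ler_nat.
rewrite -[in X in _ --> X](mulr0 A); apply: cvgM; first exact: cvg_cst.
exact: cvg_modulus_small.
Qed.

(** The weights add up to 1 and [P (phi p)] is convex. A single value thus counts as a mean of
    length zero, which brings the derivative under [mean_close]. *)
Lemma rmean0 (p : R) n : rmean phi p 0 n = P (phi p).
Proof.
rewrite /rmean; under eq_bigr do rewrite mul0r addr0.
rewrite -convex_sum; first last.
- by move=> _; rewrite invr_ge0.
- exact: convexifying_convex convP _.
rewrite sumr_const card_ord [_^-1 *+ _](_ : _ = 1) ?slscale1//.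
by rewrite -[LHS]mulr_natr mulVf ?pnatr_eq0.
Qed.

Lemma itv_convex (p q x : R) : a <= p <= b -> a <= p + q <= b ->
  0 <= x <= 1 -> a <= p + q * x <= b.
Proof.
move=> /andP[ap pb] /andP[aq qb] /andP[x0 x1].
have -> : p + q * x = (1 - x) * p + x * (p + q) by ring.
by apply/andP; split; nra.
Qed.

Lemma mean_close (m p A B : R) (V V' : X) : 0 <= m -> a <= p <= b ->
  a <= p + A <= b -> a <= p + B <= b ->
  m *s rmean phi p A n @[n --> \oo] --> V ->
  m *s rmean phi p B n @[n --> \oo] --> V' ->
  mdist V V' <= m * (I_ w `|A - B| / `|A - B|).
Proof.
move=> m0 pab Aab Bab AV BV.
have cv : m * modulus_mean w `|A - B| n @[n --> \oo] -->
    m * (I_ w `|A - B| / `|A - B|).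
  by apply: cvgM; [exact: cvg_cst|exact: cvg_modulus_mean].
apply: (ler_cvg_to (cvg_mdist AV BV) cv); near=> n.
rewrite mdist_slscale ger0_norm// ler_wpM2l//.
apply: le_trans (mdist_sum_le _ _) _; apply: ler_sum => i _.
rewrite mdist_slscale ger0_norm ?invr_ge0// ler_wpM2l ?invr_ge0//.
have i01 : 0 <= (i%:R / n.+1%:R : R) <= 1.
  by apply/andP; split; rewrite ?divr_ge0// ler_pdivrMr// mul1r ler_nat ltnW.
apply: le_trans (convexifying_lip convP _ _) _.
apply: le_trans (H_class_le _ _) _; [exact: itv_convex|exact: itv_convex|].
have -> : p + A * (i%:R / n.+1%:R) - (p + B * (i%:R / n.+1%:R)) =
  (A - B) * (i%:R / n.+1%:R) by ring.
by rewrite normrM [`|_ / _|]ger0_norm//; case/andP: i01.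
Unshelve. all: by end_near. Qed.

End IntegralMeans.

(** * Upper bounds *)

Section UpperBounds.
Context {R : realType} {X : lspaceType R} (P : X -> X).
Hypothesis convP : convexifying_operator P.
Hypothesis isoX : isotropic X.
Variables (a b : R) (w : R -> R) (phi : R -> X).
Hypothesis mw : modulus_of_continuity w.
Hypothesis Hphi : H_class a b w phi.

Let lint := lint P phi.

(** Additive form of the Newton-Leibniz formula: it exhibits the Hukuhara differences of [f] without
    any subtraction. *)
Definition primitive_of (f : R -> X) := forall c d, a <= c -> c <= d -> d <= b ->
  f d = f c +s lint c d.

Lemma primitive_cat c d e : a <= c -> c <= d -> d <= e -> e <= b ->
  lint c e = lint c d +s lint d e.
Proof. exact: (lint_cat convP mw Hphi). Qed.

(* Since [alpha L = beta l], both Riemann sums have the same weights, and their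
   tags [p + L x] and [p - l x] are at distance [(L + l) x]. *)
Lemma block_close (p L l alpha beta : R) : 0 <= L -> 0 <= l ->
  0 <= alpha -> a <= p - l -> p + L <= b -> alpha * L = beta * l ->
  mdist (alpha *s lint p (p + L)) (beta *s lint (p - l) p)
    <= alpha * L * (I_ w (L + l) / (L + l)).
Proof.
move=> L0 l0 alpha0 pa pb E.
have -> : L + l = `|L - - l| by rewrite opprK ger0_norm// addr_ge0.
apply: (mean_close convP mw Hphi (p := p)); [exact: mulr_ge0|lra|lra|lra| | ].
- rewrite (_ : (fun n => _) = fun n => alpha *s (L *s rmean P phi p L n)).
    by apply: cvg_slscale; apply: (cvg_rmean_r convP mw Hphi) => //; lra.
  by apply/funext => n; rewrite slscaleA.
- rewrite (_ : (fun n => _) = fun n => beta *s (l *s rmean P phi p (- l) n)).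
    by apply: cvg_slscale; apply: (cvg_rmean_l convP mw Hphi) => //; lra.
  by apply/funext => n; rewrite slscaleA E.
Qed.

Lemma value_close_r (t h : R) : 0 <= h -> a <= t -> t + h <= b ->
  mdist (h *s P (phi t)) (lint t (t + h)) <= I_ w h.
Proof.
move=> h0 ta tb.
have -> : I_ w h = h * (I_ w `|0 - h| / `|0 - h|).
  rewrite sub0r normrN ger0_norm//; have [->|hn] := eqVneq h 0.
    by rewrite I_0 mul0r.
  by rewrite mulrC divfK.
apply: (mean_close convP mw Hphi (p := t)); [by []|lra|lra|lra| | ].
- rewrite (_ : (fun n => _) = fun=> h *s P (phi t)); first exact: cvg_cst.
  by apply/funext => n; rewrite rmean0.
- exact: (cvg_rmean_r convP mw Hphi).
Qed.

Lemma value_close_l (t h : R) : 0 <= h -> a <= t - h -> t <= b ->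
  mdist (h *s P (phi t)) (lint (t - h) t) <= I_ w h.
Proof.
move=> h0 ta tb.
have -> : I_ w h = h * (I_ w `|0 - - h| / `|0 - - h|).
  rewrite sub0r opprK ger0_norm//; have [->|hn] := eqVneq h 0.
    by rewrite I_0 mul0r.
  by rewrite mulrC divfK.
apply: (mean_close convP mw Hphi (p := t)); [by []|lra|lra|lra| | ].
- rewrite (_ : (fun n => _) = fun=> h *s P (phi t)); first exact: cvg_cst.
  by apply/funext => n; rewrite rmean0.
- exact: (cvg_rmean_l convP mw Hphi).
Qed.

(** The mean is cut at [t], and the convex element [P (phi t)] is split in the proportion of [h1] to
    [h2]. *)
Lemma value_mean_close (t h1 h2 : R) : 0 <= h1 -> 0 <= h2 -> 0 < h1 + h2 ->
  a <= t - h1 -> t + h2 <= b ->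
  mdist (P (phi t)) ((h1 + h2)^-1 *s lint (t - h1) (t + h2))
    <= (I_ w h1 + I_ w h2) / (h1 + h2).
Proof.
move=> h10 h20 H0 ta tb.
have -> : P (phi t) = (h1 + h2)^-1 *s (h1 *s P (phi t) +s h2 *s P (phi t)).
  rewrite -(convexifying_convex convP)// slscaleA mulVf ?slscale1//.
  by rewrite gt_eqF.
rewrite mdist_slscale gtr0_norm ?invr_gt0// mulrC ler_pM2r ?invr_gt0//.
rewrite (@primitive_cat _ t); [|lra|lra|lra|lra].
apply: le_trans (mdist_sladd _ _ _ _) _; apply: lerD.
  by apply: value_close_l => //; lra.
by apply: value_close_r => //; lra.
Qed.

(** The part of density [k] on [[p1, p2]] is common to both sides and cancels. The excess of density
    [e] on [[p1, c]] and [[c, p2]] is matched with the outer blocks [[p0, p1]] and [[p2, p3]]. *)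
Lemma four_blocks_close (p0 p1 c p2 p3 e k K1 K2 : R) :
  a <= p0 -> p0 <= p1 -> p1 <= c -> c <= p2 -> p2 <= p3 -> p3 <= b ->
  0 <= e -> 0 <= k ->
  mdist (e *s lint p1 c) (k *s lint p0 p1) <= K1 ->
  mdist (e *s lint c p2) (k *s lint p2 p3) <= K2 ->
  mdist ((e + k) *s lint p1 p2) (k *s lint p0 p3) <= K1 + K2.
Proof.
move=> ap0 p01 p1c cp2 p23 p3b e0 k0 le1 le2.
have ap1 := le_trans ap0 p01; have ac := le_trans ap1 p1c.
have p2b := le_trans p23 p3b; have cb := le_trans cp2 p2b.
have p12 := le_trans p1c cp2; have ap2 := le_trans ap1 p12.
have cc1 : convex_elements (lint p1 c) by exact: (lint_convex convP mw Hphi).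
have cc2 : convex_elements (lint c p2) by exact: (lint_convex convP mw Hphi).
rewrite (@primitive_cat p0 p1 p3)// ?(le_trans p12)//.
rewrite (@primitive_cat p1 p2 p3)// (@primitive_cat p1 c p2)//.
rewrite [lint p0 p1 +s _]sladdC -sladdA [lint p2 p3 +s _]sladdC.
rewrite slscaleDr cc1// cc2// sladdACA !slscaleDr [X in mdist X _]sladdC.
apply: le_trans (mdist_sladd _ _ _ _) _; rewrite mdistxx add0r.
by apply: le_trans (mdist_sladd _ _ _ _) _; rewrite lerD.
Qed.

Lemma mean_mean_close (t g1 g2 h1 h2 : R) : 0 <= g1 -> 0 <= g2 ->
  g1 <= h1 -> g2 <= h2 -> 0 < g1 + g2 -> a <= t - h1 -> t + h2 <= b ->
  mdist ((g1 + g2)^-1 *s lint (t - g1) (t + g2))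
        ((h1 + h2)^-1 *s lint (t - h1) (t + h2)) <= K_ w g1 g2 h1 h2.
Proof.
move=> g10 g20 gh1 gh2 G0 ta tb; rewrite /K_.
(* If nothing is to be transported, the two means coincide and the leading factor of [K_] is
   zero. *)
have [D0|D0] := eqVneq ((h1 - g1) + (h2 - g2)) 0.
  have [-> ->] : h1 = g1 /\ h2 = g2 by split; lra.
  by rewrite mdistxx !subrr addr0 !mul0r.
pose G := g1 + g2; pose H := h1 + h2; pose d1 := h1 - g1; pose d2 := h2 - g2.
rewrite -/G -/H -/d1 -/d2 in D0 G0 *.
have d10 : 0 <= d1 by rewrite subr_ge0.
have d20 : 0 <= d2 by rewrite subr_ge0.
have HE : H = G + (d1 + d2) by rewrite /H /G /d1 /d2; ring.
move Dd : (d1 + d2) D0 HE => D D0 HE.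
have Dgt0 : 0 < D by rewrite lt_neqAle eq_sym D0 -Dd addr_ge0.
have H0 : 0 < H by lra.
pose e := G^-1 - H^-1.
have eE : e = D / (G * H) by rewrite /e HE; field; apply/andP; split; lra.
have e0 : 0 < e by rewrite eE divr_gt0// mulr_gt0.
(* These lengths satisfy [e * q1 = d1 / H] and [e * q2 = d2 / H], so that masses agree, and they
   exhaust the inner interval. *)
pose q1 := G * d1 / D; pose q2 := G * d2 / D.
have q10 : 0 <= q1 by rewrite /q1 divr_ge0 ?mulr_ge0// ltW.
have q20 : 0 <= q2 by rewrite /q2 divr_ge0 ?mulr_ge0// ltW.
have qG : q1 + q2 = G by rewrite /q1 /q2 -mulrDl -mulrDr Dd mulfK.
have bound d : e * (G * d / D) * (I_ w (G * d / D + d) / (G * d / D + d)) =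
    D / H ^+ 2 * I_ w (H * d / D).
  by rewrite /e HE; exact: block_constant.
have close1 : mdist (e *s lint (t - g1) (t - g1 + q1))
    (H^-1 *s lint (t - g1 - d1) (t - g1)) <= D / H ^+ 2 * I_ w (H * d1 / D).
  rewrite -bound; apply: block_close => //; rewrite ?(ltW e0)//.
  - by rewrite /d1; lra.
  - by move: qG; rewrite /G; lra.
  - by rewrite eE /q1; field; lra.
have close2 : mdist (e *s lint (t + g2 - q2) (t + g2))
    (H^-1 *s lint (t + g2) (t + g2 + d2)) <= D / H ^+ 2 * I_ w (H * d2 / D).
  rewrite -bound metric_sym -/q2.
  have eq2 : e * q2 = H^-1 * d2 by rewrite eE /q2; field; lra.
  (* Here the inner piece lies to the left of the pivot [t + g2], so the roles of the two blocks are
     exchanged. *)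
  rewrite eq2 [q2 + d2]addrC; apply: block_close => //.
  - by rewrite invr_ge0 ltW.
  - by move: qG; rewrite /G; lra.
  - by rewrite /d2; lra.
have E1 : t - g1 - d1 = t - h1 by rewrite /d1; ring.
have E2 : t + g2 + d2 = t + h2 by rewrite /d2; ring.
have E3 : t + g2 - q2 = t - g1 + q1 by move: qG; rewrite /G; lra.
rewrite E1 in close1; rewrite E2 E3 in close2.
set c := t - g1 + q1 in close1 close2 E3.
have cg1 : t - g1 <= c by rewrite /c; lra.
have cg2 : c <= t + g2 by lra.
have Hinv : 0 <= H^-1 by rewrite invr_ge0 ltW.
rewrite mulrDr (_ : G^-1 = e + H^-1); last by rewrite subrK.
apply: (four_blocks_close _ _ cg1 cg2 _ _ (ltW e0) Hinv close1 close2) => //.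
- by rewrite lerB.
- by rewrite lerD.
Qed.

Lemma primitive_hderivative f (t : R) : a < b -> a <= t <= b ->
  primitive_of f -> hderivative a b t f = P (phi t).
Proof.
move=> ab /andP[at_ tb] fE.
(* Means over segments of length [g] containing [t] are within [w g] of [P (phi t)]; this serves
   both one-sided quotients. *)
have key (F : R -> X) (u v : R -> R) :
    (\forall g \near (0 : R)^'+, [/\ a <= u g, v g <= b, v g - u g = g,
       u g <= t <= v g & F g = g^-1 *s lint (u g) (v g)]) ->
    F g @[g --> (0 : R)^'+] --> P (phi t).
  move=> near_uv.
  apply/metric_structure.metricType_numDomainType.cvgrPdist_lt => e e0.
  have [r r0 wr] := modulus_near0 mw e0.
  near=> g.
  have [ua vb vu /andP[ut tv] ->] :
    [/\ a <= u g, v g <= b, v g - u g = g, u g <= t <= v g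
      & F g = g^-1 *s lint (u g) (v g)] by near: g.
  have g0 : 0 < g by near: g; exact: nbhs_right_gt.
  have gr : g < r by near: g; exact: nbhs_right_lt.
  have uv : u g <= v g by lra.
  have wg0 := modulus_ge0 mw (ltW g0).
  have := lint_near_cst convP mw Hphi (x := phi t) ua uv vb wg0.
  rewrite vu -/lint => H.
  have {}H : mdist (lint (u g) (v g)) (g *s P (phi t)) <= g * w g.
    apply: H => s /andP[us sv]; apply: le_trans (H_class_le Hphi _ _) _; [lra|lra|].
    by apply: (modulus_nondecreasing mw) => //; rewrite ler_norml; lra.
  rewrite metric_sym -[P (phi t)]slscale1 -(mulVf (lt0r_neq0 g0)) -slscaleA.
  rewrite mdist_slscale gtr0_norm ?invr_gt0// mulrC ltr_pdivrMr//.
  apply: le_lt_trans H _; rewrite mulrC ltr_pM2r//.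
  by apply: wr; exact: ltW.
have right_ok : t < b ->
    (\forall g \near (0 : R)^'+, hdiff_exists (f (t + g)) (f t)) /\
    g^-1 *s hdiff (f (t + g)) (f t) @[g --> (0 : R)^'+] --> P (phi t).
  move=> ltb; have nr : \forall g \near (0 : R)^'+, 0 < g /\ t + g <= b.
    near=> g; split; first by near: g; exact: nbhs_right_gt.
    rewrite -lerBrDl; apply/ltW; near: g; apply: nbhs_right_lt.
    by rewrite subr_gt0.
  split.
    apply: filterS nr => g [g0 gb]; exists (lint t (t + g)).
    by apply: fE => //; lra.
  apply: (key _ (fun=> t) (fun g => t + g)); apply: filterS nr => g [g0 gb].
  split=> //; [ring|lra|].
  by rewrite (fE t (t + g)) ?hdiff_sladd//; lra.
have left_ok : a < t ->
    (\forall g \near (0 : R)^'+, hdiff_exists (f t) (f (t - g))) /\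
    g^-1 *s hdiff (f t) (f (t - g)) @[g --> (0 : R)^'+] --> P (phi t).
  move=> lta; have nr : \forall g \near (0 : R)^'+, 0 < g /\ a <= t - g.
    near=> g; split; first by near: g; exact: nbhs_right_gt.
    rewrite lerBrDl -lerBrDr; apply/ltW; near: g; apply: nbhs_right_lt.
    by rewrite subr_gt0.
  split.
    apply: filterS nr => g [g0 gb]; exists (lint (t - g) t).
    by apply: fE => //; lra.
  apply: (key _ (fun g => t - g) (fun=> t)); apply: filterS nr => g [g0 gb].
  split=> //; [ring|lra|].
  by rewrite (fE (t - g) t) ?hdiff_sladd//; lra.
apply: xget_unique => [|y [yr yl]]; first by split.
have uniq (F : R -> X) (u v : X) : F g @[g --> (0 : R)^'+] --> u ->
    F g @[g --> (0 : R)^'+] --> v -> u = v.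
  by move=> Fu Fv; exact: (cvg_unique (@metric_hausdorff _ X) Fu Fv).
(* A derivative is tested only on the sides available at [t]; [a < b] ensures that there is one. *)
have [ltb|tb'] := ltP t b.
  exact: uniq (yr ltb).2 (right_ok ltb).2.
have lta : a < t by lra.
exact: uniq (yl lta).2 (left_ok lta).2.
Unshelve. all: by end_near. Qed.

Lemma primitive_divided_difference f (t h1 h2 : R) : 0 <= h1 -> 0 <= h2 ->
  a <= t - h1 -> t + h2 <= b -> primitive_of f ->
  divided_difference h1 h2 t f = (h1 + h2)^-1 *s lint (t - h1) (t + h2).
Proof.
move=> h10 h20 ta tb fE; rewrite /divided_difference.
by rewrite (fE (t - h1) (t + h2)) ?hdiff_sladd//; lra.
Qed.

End UpperBounds.

(** * Functions of the class [W1H_class] as primitives *)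

Section W1HPrimitives.
Context {R : realType} {X : lspaceType R} (P : X -> X).
Hypothesis convP : convexifying_operator P.
Variables (a b : R) (w : R -> R).
Hypothesis mw : modulus_of_continuity w.
Hypothesis ab : a <= b.

Lemma W1H_primitive f : W1H_class a b P w f ->
  exists2 phi, H_class a b w phi & primitive_of P a b phi f.
Proof.
move=> [x [phi [cx Hphi fE]]]; exists phi => // c d ac cd db.
have fl s : a <= s <= b -> f s = x +s lint P phi a s.
  move=> sab; have [|v iv ->] := fE s; first by rewrite in_itv.
  by rewrite (lint_unique convP iv).
rewrite !fl; [|lra|lra].
by rewrite (lint_cat convP mw Hphi (d := c)) ?sladdA//.
Qed.

Lemma primitive_W1H (phi : R -> X) (x : X) : convex_elements x ->
  H_class a b w phi -> W1H_class a b P w (fun s => x +s lint P phi a s).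
Proof.
move=> cx Hphi; exists x, phi; split => // s; rewrite in_itv /= => /andP[as_ sb].
by exists (lint P phi a s) => //; exact: (lintP convP mw Hphi).
Qed.

End W1HPrimitives.

(** * Lower bounds *)

Section Operators.
Context {R : realType} {X : lspaceType R}.
Hypothesis isoX : isotropic X.
Variables a b : R.

Lemma within_continuousP (f : R -> X) :
  {within `[a, b], continuous f} <->
  forall x, x \in `[a, b] -> forall e, 0 < e ->
    \forall s \near within `[a, b] (nbhs x), mdist (f x) (f s) < e.
Proof.
split=> [/subspace_continuousP fc x xab e e0|fc].
  have /metric_structure.metricType_numDomainType.cvgrPdist_lt := fc x xab.
  by apply.
apply/subspace_continuousP => x xab.
apply/metric_structure.metricType_numDomainType.cvgrPdist_lt => e e0.
exact: fc.
Qed.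

Lemma CH_scale (k : R) (f : R -> X) : CH_class a b f ->
  CH_class a b (fun s => k *s f s).
Proof.
move=> [/within_continuousP fc fd]; split.
  apply/within_continuousP => x xab e e0.
  have k1 : 0 < `|k| + 1 by rewrite ltr_wpDl.
  apply: filterS (fc x xab (e / (`|k| + 1)) (divr_gt0 e0 k1)) => s.
  rewrite ltr_pdivlMr// => fs; rewrite mdist_slscale; apply: le_lt_trans fs.
  by rewrite mulrC ler_wpM2l ?mdist_ge0// lerDl.
move=> s g1 g2 g10 g20 as_ sb; have [z ->] := fd _ _ _ g10 g20 as_ sb.
by exists (k *s z); rewrite slscaleDr.
Qed.

(** Scaling by [M^-1] puts [f] into the unit ball; homogeneity is available for positive factors,
    whence [0 < M]. *)
Lemma operator_bound (T : (R -> X) -> X) (N M : R) (f : R -> X) :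
  pos_homogeneous_operator a b T -> (operator_norm a b T <= N%:E)%E ->
  CH_class a b f -> 0 < M -> (forall s, s \in `[a, b] -> hnorm (f s) <= M) ->
  hnorm (T f) <= N * M.
Proof.
move=> [_ Thom] TN fCH M0 fM.
pose g s := M^-1 *s f s.
have gCH : CH_class a b g by exact: CH_scale.
have -> : T f = M *s T g.
  by rewrite Thom ?invr_gt0// slscaleA divff ?slscale1// gt_eqF.
rewrite hnorm_slscale gtr0_norm// mulrC ler_pM2r// -lee_fin.
apply: le_trans TN; apply: ereal_sup_ubound; exists g => //; split => //.
apply: ge_ereal_sup => _ [s sab <-]; rewrite lee_fin hnorm_slscale.
by rewrite gtr0_norm ?invr_gt0// mulrC ler_pdivrMr// mul1r fM.
Qed.

Lemma divided_difference_homogeneous (t h1 h2 : R) : 0 <= h1 -> 0 <= h2 ->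
  0 < h1 + h2 -> a <= t - h1 -> t + h2 <= b ->
  pos_homogeneous_operator a b (divided_difference (X := X) h1 h2 t).
Proof.
move=> h10 h20 H0 ta tb; split => [f g _ _ fg|k f [_ fd] k0].
  by rewrite /divided_difference !fg// in_itv /=; apply/andP; split; lra.
rewrite /divided_difference.
have [z zE] : hdiff_exists (f (t + h2)) (f (t - h1)).
  (* At an end of [[a, b]] one of [h1], [h2] is zero, while [CH_class] speaks of positive
     increments; the segment is therefore centred at its midpoint. *)
  have := fd ((t - h1) + (h1 + h2) / 2) ((h1 + h2) / 2) ((h1 + h2) / 2).
  rewrite addrK -addrA -splitr (_ : t - h1 + (h1 + h2) = t + h2); last ring.
  by apply => //; lra.
rewrite zE slscaleDr !hdiff_sladd// !slscaleA.
by rewrite mulrC.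
Qed.

(** By isotropy the norm of the difference is the distance between two values of [f], each of norm
    at most 1. *)
Lemma divided_difference_norm (t h1 h2 : R) : 0 <= h1 -> 0 <= h2 ->
  0 < h1 + h2 -> a <= t - h1 -> t + h2 <= b ->
  (operator_norm a b (divided_difference (X := X) h1 h2 t)
    <= (2 / (h1 + h2))%:E)%E.
Proof.
move=> h10 h20 H0 ta tb.
apply: ge_ereal_sup => _ [f [[_ fd] fn] <-]; rewrite lee_fin.
have [z zE] : hdiff_exists (f (t + h2)) (f (t - h1)).
  have := fd ((t - h1) + (h1 + h2) / 2) ((h1 + h2) / 2) ((h1 + h2) / 2).
  rewrite addrK -addrA -splitr (_ : t - h1 + (h1 + h2) = t + h2); last ring.
  by apply => //; lra.
rewrite /divided_difference zE hdiff_sladd// hnorm_slscale.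
rewrite gtr0_norm ?invr_gt0// mulrC ler_pM2r ?invr_gt0//.
have fle s : a <= s <= b -> hnorm (f s) <= 1.
  move=> sab; rewrite -lee_fin; apply: le_trans fn.
  by apply: ereal_sup_ubound; exists s => //=; rewrite in_itv.
have -> : hnorm z = mdist (f (t + h2)) (f (t - h1)).
  by rewrite zE /hnorm -(isoX z theta (f (t - h1))) sladd0x sladdC.
apply: le_trans (metric_triangle _ theta _) _; rewrite (metric_sym theta).
have -> : 2 = 1 + 1 :> R by [].
by apply: lerD; apply: fle; lra.
Qed.

End Operators.

(** * Real functions embedded along a convex invertible unit element, and the resulting lower bound
    for [E_] *)

Section LowerBound.
Context {R : realType} {X : lspaceType R} (P : X -> X).
Hypothesis convP : convexifying_operator P.
Hypothesis isoX : isotropic X.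
Variables (a b : R) (w : R -> R).
Hypothesis mw : modulus_of_continuity w.
Hypothesis ab : a < b.

Lemma unit_convex_invertible :
  invertible_elements `&` convex_elements <> [set (theta : X)] ->
  exists e e' : X, [/\ convex_elements e, convex_elements e',
    e +s e' = theta & hnorm e = 1].
Proof.
move=> nontriv.
have [x [[x' xx'] cx] xn] : exists2 x : X,
    (invertible_elements `&` convex_elements) x & x <> theta.
  apply: contrapT => nex; apply: nontriv; apply/seteqP; split => x /=.
    by move=> xic; apply: contrapT => xn; apply: nex; exists x.
  by move=> ->; split; [exists theta; rewrite sladdx0|exact: convex_theta].
have n0 : 0 < hnorm x by rewrite /hnorm mdist_gt0; apply/eqP.
have cx' := convex_inverse isoX cx xx'.
exists ((hnorm x)^-1 *s x), ((hnorm x)^-1 *s x'); split.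
- exact: convex_slscale.
- exact: convex_slscale.
- by rewrite -slscaleDr xx' slscalex0.
- by rewrite hnorm_slscale gtr0_norm ?invr_gt0// mulVf// gt_eqF.
Qed.

(** The differences are integrals of [phi], and boundedness of [phi] makes [f] Lipschitz. *)
Lemma primitive_CH (phi f : R -> X) : H_class a b w phi ->
  primitive_of P a b phi f -> CH_class a b f.
Proof.
move=> Hphi fE; split; last first.
  move=> s g1 g2 g10 g20 as_ sb; exists (lint P phi (s - g1) (s + g2)).
  by apply: fE => //; lra.
pose C := hnorm (phi a) + w (b - a).
have ba0 : 0 <= b - a by rewrite subr_ge0 ltW.
have C0 : 0 <= C by rewrite addr_ge0 ?hnorm_ge0// (modulus_ge0 mw).
have phiC s : a <= s <= b -> hnorm (phi s) <= C.
  move=> sab; apply: le_trans (metric_triangle _ (phi a) _) _.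
  rewrite addrC lerD2l; apply: le_trans (H_class_le Hphi _ _) _; [lra|lra|].
  by apply: (modulus_nondecreasing mw) => //; rewrite ger0_norm; lra.
have lip x y : a <= x -> x <= y -> y <= b -> mdist (f x) (f y) <= (y - x) * C.
  move=> ax xy yb; rewrite (fE x y)// -{1}(sladdx0 (f x)) ![f x +s _]sladdC isoX.
  rewrite metric_sym; apply: (lint_bound convP mw Hphi) => // s sxy.
  by apply: phiC; lra.
have lip' x y : a <= x <= b -> a <= y <= b -> mdist (f x) (f y) <= `|x - y| * C.
  move=> /andP[ax xb] /andP[ay yb]; have [xy|yx] := leP x y.
    by rewrite distrC ger0_norm ?subr_ge0//; exact: lip.
  rewrite metric_sym ger0_norm ?subr_ge0 ?(ltW yx)//.
  by apply: lip => //; exact: ltW.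
apply/within_continuousP => x; rewrite in_itv /= => xab e e0.
have C1 : 0 < C + 1 by rewrite ltr_wpDl.
apply/nbhs_ballP; exists (e / (C + 1)) => /=; first exact: divr_gt0.
move=> s; rewrite /ball /= in_itv /= ltr_pdivlMr// => xs sab.
apply: le_lt_trans (lip' _ _ xab sab) _; apply: le_lt_trans xs.
by rewrite ler_wpM2l// lerDl.
Qed.

Variables (e e' : X).
Hypothesis (ce : convex_elements e) (ce' : convex_elements e').
Hypothesis (ee' : e +s e' = theta) (e1 : hnorm e = 1).

Variable phi : R -> R.
Hypothesis phi_ge0 : forall s, 0 <= phi s.
Hypothesis phiH : forall s t, a <= s <= b -> a <= t <= b ->
  `|phi s - phi t| <= w `|s - t|.

Let Phi s := phi s *s e.
(** As [phi] is nonnegative, this is the real integral of [phi] over [[c, d]], read off as a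
    norm. *)
Let j c d := hnorm (lint P Phi c d).

Lemma embed_H_class : H_class a b w Phi.
Proof.
move=> s t; rewrite !in_itv /= => sab tab.
by rewrite mdist_slscale_convex// e1 mulr1 phiH.
Qed.

Definition real_mean (p A : R) (n : nat) : R :=
  \sum_(i < n.+1) n.+1%:R^-1 * phi (p + A * (i%:R / n.+1%:R)).

Lemma real_mean_ge0 p A n : 0 <= real_mean p A n.
Proof. by apply: sumr_ge0 => i _; rewrite mulr_ge0// invr_ge0. Qed.

Lemma rmean_embed p A n : rmean P Phi p A n = real_mean p A n *s e.
Proof.
rewrite /real_mean convex_sum//; last by move=> i; rewrite mulr_ge0// invr_ge0.
apply: eq_bigr => i _.
by rewrite (convexifying_scale convP) (convexifying_fix convP ce) slscaleA.
Qed.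

(** The coefficients [k * r n] are the norms of a convergent sequence, hence converge; the isometry
    of the ray of [e] then identifies the limit. *)
Lemma cvg_embed (k : R) (r : nat -> R) (v : X) : 0 <= k -> (forall n, 0 <= r n) ->
  k *s (r n *s e) @[n --> \oo] --> v ->
  k * r n @[n --> \oo] --> hnorm v /\ v = hnorm v *s e.
Proof.
move=> k0 r0 rv.
have kr n : 0 <= k * r n by rewrite mulr_ge0.
have cr : k * r n @[n --> \oo] --> hnorm v.
  rewrite (_ : (fun n => k * r n) = fun n => mdist (k *s (r n *s e)) theta).
    by apply: cvg_mdist => //; exact: cvg_cst.
  apply/funext => n; rewrite slscaleA -/(hnorm _) hnorm_slscale e1 mulr1.
  by rewrite ger0_norm.
split => //; apply: cvg_mdist_uniq rv _.
apply: (@cvg_mdist0 _ _ _ _ (fun n => `|k * r n - hnorm v|)).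
  by move=> n; rewrite slscaleA mdist_slscale_convex ?hnorm_ge0// e1 mulr1.
rewrite -(normr0 R); apply: cvg_norm; rewrite -(subrr (hnorm v)).
by apply: cvgB => //; exact: cvg_cst.
Qed.

Lemma cvg_real_mean_r (p A : R) : 0 <= A -> a <= p -> p + A <= b ->
  A * real_mean p A n @[n --> \oo] --> j p (p + A).
Proof.
move=> A0 ap pb; have := cvg_rmean_r convP mw embed_H_class A0 ap pb.
under eq_fun do rewrite rmean_embed.
by move=> /(cvg_embed A0 (real_mean_ge0 p A))[].
Qed.

Lemma cvg_real_mean_l (p A : R) : 0 <= A -> a <= p - A -> p <= b ->
  A * real_mean p (- A) n @[n --> \oo] --> j (p - A) p.
Proof.
move=> A0 ap pb; have := cvg_rmean_l convP mw embed_H_class A0 ap pb.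
under eq_fun do rewrite rmean_embed.
by move=> /(cvg_embed A0 (real_mean_ge0 p (- A)))[].
Qed.

Lemma lint_embed c d : a <= c -> c <= d -> d <= b -> lint P Phi c d = j c d *s e.
Proof.
move=> ac cd db; have A0 : 0 <= d - c by rewrite subr_ge0.
have dE : d = c + (d - c) by ring.
have db' : c + (d - c) <= b by rewrite -dE.
have := cvg_rmean_r convP mw embed_H_class A0 ac db'.
under eq_fun do rewrite rmean_embed.
by move=> /(cvg_embed A0 (real_mean_ge0 c (d - c)))[_ E]; rewrite [d in LHS]dE E -dE.
Qed.

Lemma embed_cat c d f : a <= c -> c <= d -> d <= f -> f <= b ->
  j c f = j c d + j d f.
Proof.
move=> ac cd df fb; rewrite /j (lint_cat convP mw embed_H_class (d := d))//.
rewrite !lint_embed ?(le_trans ac)// ?(le_trans df)//.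
rewrite -ce ?hnorm_ge0// !hnorm_slscale e1 !mulr1.
by rewrite !ger0_norm ?addr_ge0 ?hnorm_ge0.
Qed.

Lemma embed_zero c d : a <= c -> c <= d -> d <= b ->
  (forall s, c <= s <= d -> phi s = 0) -> j c d = 0.
Proof.
move=> ac cd db phi0; apply/eqP; rewrite eq_le hnorm_ge0 andbT.
rewrite -(mulr0 (d - c)); apply: (lint_bound convP mw embed_H_class) => // s scd.
by rewrite /Phi phi0// slscale0 /hnorm mdistxx.
Qed.

(** Equality case of [mean_close]: when [phi] realizes [w] along the paired tags, the Riemann sums
    differ exactly by a sum for [w]. *)
Lemma mean_diff (m p A B M V V' : R) : 0 <= M ->
  (forall x, 0 <= x <= 1 -> phi (p + A * x) - phi (p + B * x) = w (M * x)) ->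
  m * real_mean p A n @[n --> \oo] --> V ->
  m * real_mean p B n @[n --> \oo] --> V' ->
  V - V' = m * (I_ w M / M).
Proof.
move=> M0 phiE AV BV.
have cv : m * modulus_mean w M n @[n --> \oo] --> m * (I_ w M / M).
  by apply: cvgM; [exact: cvg_cst|exact: cvg_modulus_mean].
have := cvgB AV BV.
rewrite (_ : (fun n => _) - _ = fun n => m * modulus_mean w M n).
  by move=> cv'; exact: (cvg_unique (@Rhausdorff R) (cv' _) cv).
apply/funext => n /=; rewrite [LHS](_ : _ = m * (real_mean p A n - real_mean p B n)).
  congr (_ * _); rewrite -sumrB; apply: eq_bigr => i _.
  rewrite -mulrBr phiE// divr_ge0//= ler_pdivrMr// mul1r ler_nat ltnW//.
by rewrite mulrBr.
Qed.

(* [e'] plays the role of [- e]: [f] grows along [e] from [- j a b / 2] to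
   [j a b / 2]. *)
Let f s := (j a b / 2) *s e' +s lint P Phi a s.

Lemma extremal_primitive : primitive_of P a b Phi f.
Proof.
move=> c d ac cd db; rewrite /f (lint_cat convP mw embed_H_class (d := c))//.
by rewrite sladdA.
Qed.

Lemma extremal_W1H : W1H_class a b P w f.
Proof.
apply: (primitive_W1H convP mw) embed_H_class.
exact: convex_slscale.
Qed.

Lemma extremal_bound s : a <= s <= b -> hnorm (f s) <= j a b / 2.
Proof.
have half (x y z : R) : z = x + y -> 0 <= x -> 0 <= y -> `|z / 2 - x| <= z / 2.
  by move=> -> x0 y0; rewrite ler_norml; lra.
move=> /andP[as_ sb]; rewrite /f lint_embed//.
set k := j a b / 2.
have k0 : 0 <= k by rewrite divr_ge0 ?hnorm_ge0.
(* Adding [k *s e] to both arguments cancels [k *s e'] and leaves the distance between two multiples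
   of [e]. *)
rewrite /hnorm -(isoX _ _ (k *s e)) sladd0x sladdC sladdA.
rewrite -slscaleDr ee' slscalex0 sladd0x mdist_slscale_convex ?hnorm_ge0//.
rewrite e1 mulr1 distrC.
exact: half (embed_cat (lexx a) as_ sb (lexx b)) (hnorm_ge0 _) (hnorm_ge0 _).
Qed.

(** For every admissible [T], the single function [f] already gives the bound: [A f] and [T f] are
    at distance at least the difference of their norms, and the norm of [T f] is at most [N] times
    that of [f]. *)
Lemma E_lower_bound (A : (R -> X) -> X) (N : R) : 0 <= N ->
  ((hnorm (A f) - N * (j a b / 2))%:E <= E_ a b P w A N)%E.
Proof.
move=> N0; apply: le_ereal_inf_tmp => _ [T [Thom _ TN] <-].
apply: (@le_trans _ _ (mdist (A f) (T f))%:E); last first.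
  by apply: ereal_sup_ubound; exists f => //; exact: extremal_W1H.
rewrite lee_fin lerBlDr.
apply: le_trans (metric_triangle _ (T f) _) _; rewrite lerD2l.
have fCH := primitive_CH embed_H_class extremal_primitive.
have j0 : 0 <= j a b / 2 by rewrite divr_ge0 ?hnorm_ge0.
(* The bound [j a b / 2] may be zero, whereas [operator_bound] takes a positive one; the slack
   [eta / (N + 1)] repairs this. *)
apply/ler_addgt0Pr => eta eta0.
have N1 : 0 < N + 1 by rewrite ltr_wpDl.
have d0 : 0 < eta / (N + 1) by rewrite divr_gt0.
apply: le_trans (operator_bound Thom TN fCH (M := j a b / 2 + eta / (N + 1)) _ _) _.
- by rewrite ltr_wpDl.
- move=> s; rewrite in_itv /= => /extremal_bound /le_trans; apply.
  by rewrite lerDl ltW.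
rewrite mulrDr lerD2l mulrA ler_pdivrMr// mulrC ler_pM2l//.
by rewrite lerDl.
Qed.

End LowerBound.

(** * Extremal functions *)

Section Truncation.
Context {R : realType}.
Implicit Types x y : R.

Lemma max0_dist x y : `|Num.max 0 x - Num.max 0 y| <= `|x - y|.
Proof.
wlog xy : x y / x <= y => [wl|].
  have [|/ltW] := leP x y; first exact: wl.
  by rewrite distrC [`|x - y|]distrC; exact: wl.
rewrite distrC [`|x - y|]distrC [X in _ <= X]ger0_norm ?subr_ge0//.
by rewrite ler_norml; case: (leP 0 x) => ?; case: (leP 0 y) => ?; lra.
Qed.

End Truncation.

(** * The profile built from a concave modulus *)

Section ConcaveProfile.
Context {R : realType} (w : R -> R).
Hypothesis mw : modulus_of_continuity w.
Hypothesis cw : concave_modulus w.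
Variables G D : R.
Hypothesis (G0 : 0 < G) (D0 : 0 < D).
Let H := G + D.

Let H0 : 0 < H. Proof. exact: addr_gt0. Qed.

(** Since [G / H] and [D / H] add up to 1, the values at [G * x] and [- (D * x)], for [x >= 0],
    differ by exactly [w (H * x)], the largest amount that [w] allows at that distance. *)
Definition profile (v : R) : R :=
  if 0 <= v then G / H * w (H / G * v) else - (D / H * w (H / D * - v)).

Lemma concave_scale (l x : R) : 0 <= l -> l <= 1 -> 0 <= x ->
  l * w x <= w (l * x).
Proof.
move=> l0 l1 x0; have := cw x0 (lexx 0) l0 l1.
by rewrite (modulus0 mw) !mulr0 !addr0.
Qed.

(** Used with [K = G] and [K = D], one for each branch. Semi-additivity bounds the increment by
    [K / H * w (H / K * (v - u))], and concavity together with [w 0 = 0] absorbs the factor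
    [K / H]. *)
Lemma concave_scale_diff (K u v : R) : 0 < K -> K <= H -> 0 <= u -> u <= v ->
  0 <= K / H * w (H / K * v) - K / H * w (H / K * u) <= w (v - u).
Proof.
move=> K0 KH u0 uv.
have KH0 : 0 <= K / H by rewrite divr_ge0// ltW.
have HK0 : 0 <= H / K by rewrite divr_ge0// ltW.
have KH1 : K / H <= 1 by rewrite ler_pdivrMr// mul1r.
have uv' : H / K * u <= H / K * v by rewrite ler_wpM2l.
have u0' : 0 <= H / K * u by rewrite mulr_ge0.
have vu0 : 0 <= H / K * (v - u) by rewrite mulr_ge0// subr_ge0.
rewrite -mulrBr mulr_ge0//=; last first.
  by rewrite subr_ge0 (modulus_nondecreasing mw).
have -> : v - u = K / H * (H / K * (v - u)) by field; rewrite !lt0r_neq0.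
apply: le_trans (concave_scale KH0 KH1 vu0); rewrite ler_wpM2l// lerBlDr.
have {1}-> : H / K * v = H / K * (v - u) + H / K * u by ring.
exact: (modulus_semiadditive mw).
Qed.

Lemma profile_diff (u v : R) : u <= v ->
  0 <= profile v - profile u <= w (v - u).
Proof.
move=> uv; rewrite /profile; have [u0|u0] := leP 0 u.
  rewrite (le_trans u0 uv); apply: concave_scale_diff => //.
  by rewrite /H lerDl ltW.
have DH : D <= H by rewrite /H lerDr ltW.
have [v0|v0] := leP 0 v; last first.
  have v0' : 0 <= - v by rewrite oppr_ge0 ltW.
  have uv' : - v <= - u by rewrite lerN2.
  have := concave_scale_diff D0 DH v0' uv'.
  have -> : - u - - v = v - u by ring.
  by rewrite opprK [- (_ * _) + _]addrC.
have GH0 : 0 <= G / H by rewrite divr_ge0// ltW.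
have DH0 : 0 <= D / H by rewrite divr_ge0// ltW.
have v0' : 0 <= H / G * v by rewrite mulr_ge0// divr_ge0// ltW.
have u0' : 0 <= H / D * - u by rewrite mulr_ge0 ?divr_ge0 ?ltW// oppr_gt0.
rewrite opprK; apply/andP; split.
  by rewrite addr_ge0// mulr_ge0// (modulus_ge0 mw).
have GH1 : G / H <= 1 by rewrite ler_pdivrMr// mul1r /H lerDl ltW.
(* For arguments of opposite signs the increment is a convex combination of two values of [w]; the
   same combination of the arguments is [v - u]. *)
have := cw v0' u0' GH0 GH1.
have -> : 1 - G / H = D / H.
  by rewrite -(divff (lt0r_neq0 H0)) -mulrBl /H [G + D]addrC addrK.
have -> : G / H * (H / G * v) + D / H * (H / D * - u) = v - u.
  by field; rewrite !lt0r_neq0.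
by [].
Qed.

Lemma profile_opp (x : R) : 0 <= x ->
  profile (G * x) - profile (- (D * x)) = w (H * x).
Proof.
move=> x0; rewrite /profile mulr_ge0 ?(ltW G0)//.
have -> : H / G * (G * x) = H * x by field; rewrite !lt0r_neq0.
have [Dx|Dx] := leP 0 (- (D * x)); last first.
  have -> : H / D * - - (D * x) = H * x by field; rewrite !lt0r_neq0.
  by rewrite opprK -mulrDl -mulrDl -/H divff ?mul1r// gt_eqF.
(* Only [x = 0] reaches the nonnegative branch at [- (D * x)]. *)
have -> : x = 0.
  apply/eqP; rewrite eq_le x0 andbT; move: Dx; rewrite oppr_ge0.
  by rewrite pmulr_rle0.
by rewrite !(mulr0, oppr0) (modulus0 mw) mulr0 subrr.
Qed.

Lemma profile_incr (u v : R) : u <= v -> profile u <= profile v.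
Proof. by move=> /profile_diff/andP[+ _]; rewrite subr_ge0. Qed.

Variables pl pr c : R.

(** A copy centred at [pl] and a reflected copy centred at [pr], shifted vertically so that both
    vanish at [c], where they meet in a peak. *)
Definition two_sided_profile (s : R) : R :=
  if s <= c then profile (s - pl) - profile (c - pl)
  else profile (pr - s) - profile (pr - c).

Lemma two_sided_profile_l s : s <= c ->
  two_sided_profile s = profile (s - pl) - profile (c - pl).
Proof. by rewrite /two_sided_profile => ->. Qed.

Lemma two_sided_profile_r s : c <= s ->
  two_sided_profile s = profile (pr - s) - profile (pr - c).
Proof.
rewrite /two_sided_profile; case: (leP s c) => // sc cs.
have -> : s = c by apply/eqP; rewrite eq_le sc cs.
by rewrite !subrr.
Qed.

(** Across the peak [c] the two drops partly cancel, so the larger one bounds the difference; on one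
    side of [c] the bound is [profile_diff]. *)
Lemma two_sided_profile_dist (s s' : R) :
  `|two_sided_profile s - two_sided_profile s'| <= w `|s - s'|.
Proof.
wlog ss : s s' / s <= s' => [wl|].
  have [|/ltW] := leP s s'; first exact: wl.
  by rewrite distrC [`|s - s'|]distrC; exact: wl.
rewrite [`|s - s'|]distrC (ger0_norm (x := s' - s)) ?subr_ge0//.
have [s'c|cs'] := leP s' c.
  rewrite !two_sided_profile_l ?(le_trans ss)//.
  have := profile_diff (lerB ss (lexx pl)).
  have -> : s' - pl - (s - pl) = s' - s by ring.
  by move=> H1; rewrite ler_norml; lra.
have [cs|sc] := leP c s.
  rewrite !two_sided_profile_r ?(ltW cs')//.
  have := profile_diff (lerB (lexx pr) ss).
  have -> : pr - s - (pr - s') = s' - s by ring.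
  by move=> H1; rewrite ler_norml; lra.
rewrite two_sided_profile_l ?(ltW sc)// two_sided_profile_r ?(ltW cs')//.
have := profile_diff (lerB (ltW sc) (lexx pl)).
have := profile_diff (lerB (lexx pr) (ltW cs')).
have -> : pr - c - (pr - s') = s' - c by ring.
have -> : c - pl - (s - pl) = c - s by ring.
have w1 : w (s' - c) <= w (s' - s) by apply: (modulus_nondecreasing mw); lra.
have w2 : w (c - s) <= w (s' - s) by apply: (modulus_nondecreasing mw); lra.
by move=> H1 H2; rewrite ler_norml; lra.
Qed.

End ConcaveProfile.

(** * Optimality from matching bounds, and localization of the extremal integral *)

Section Assembly.
Context {R : realType} {X : lspaceType R} (P : X -> X).
Hypothesis convP : convexifying_operator P.
Hypothesis isoX : isotropic X.
Variables (a b : R) (w : R -> R).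
Hypothesis mw : modulus_of_continuity w.
Hypothesis ab : a < b.

(** The divided difference is itself admissible in the infimum, which closes the chain from [v]
    through [E_] and [U_] back to [v]. *)
Lemma optimal_recovery (A : (R -> X) -> X) (t h1 h2 v : R) :
  0 <= h1 -> 0 <= h2 -> 0 < h1 + h2 -> a <= t - h1 -> t + h2 <= b ->
  (forall f, W1H_class a b P w f ->
     mdist (A f) (divided_difference h1 h2 t f) <= v) ->
  (v%:E <= E_ a b P w A (2 / (h1 + h2)))%E ->
  E_ a b P w A (2 / (h1 + h2)) = U_ a b P w A (divided_difference h1 h2 t) /\
  U_ a b P w A (divided_difference h1 h2 t) = v%:E.
Proof.
move=> h10 h20 H0 ta tb Uv vE.
have EU : (E_ a b P w A (2 / (h1 + h2)) <=
    U_ a b P w A (divided_difference h1 h2 t))%E.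
  apply: ereal_inf_lbound; exists (divided_difference h1 h2 t) => //.
  have norm_le := divided_difference_norm isoX h10 h20 H0 ta tb.
  split => //; first exact: divided_difference_homogeneous.
  by apply: le_lt_trans norm_le _; exact: ltry.
have Uv' : (U_ a b P w A (divided_difference h1 h2 t) <= v%:E)%E.
  by apply: ge_ereal_sup => _ [f fW <-]; rewrite lee_fin Uv.
have U_eq : U_ a b P w A (divided_difference h1 h2 t) = v%:E.
  by apply/eqP; rewrite eq_le Uv' (le_trans vE EU).
by split => //; apply/eqP; rewrite eq_le EU U_eq vE.
Qed.

Variables (e e' : X).
Hypothesis (ce : convex_elements e) (ce' : convex_elements e').
Hypothesis (ee' : e +s e' = theta) (e1 : hnorm e = 1).
Variable phi : R -> R.
Hypothesis phi_ge0 : forall s, 0 <= phi s.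
Hypothesis phiH : forall s t, a <= s <= b -> a <= t <= b ->
  `|phi s - phi t| <= w `|s - t|.

Let j c d := hnorm (lint P (fun s => phi s *s e) c d).

Let cat := embed_cat convP isoX mw ce e1 phi_ge0 phiH.

Let Phi_H : H_class a b w (fun s => phi s *s e).
Proof. exact: embed_H_class. Qed.

(** Vanishing is required only on a side where [[c, d]] stops short of [[a, b]]; on the other side
    the remainder is a single point. *)
Lemma embed_support c d : a <= c -> c <= d -> d <= b ->
  (a < c -> forall s, s <= c -> phi s = 0) ->
  (d < b -> forall s, d <= s -> phi s = 0) -> j a b = j c d.
Proof.
move=> ac cd db zl zr.
have ad := le_trans ac cd; have cb := le_trans cd db.
have zero := embed_zero convP isoX mw ce e1 phi_ge0 phiH.
have jac : j a c = 0.
  have [lac|ca] := ltP a c.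
    by apply: zero => // s /andP[_ sc]; exact: zl.
  have -> : c = a by apply/eqP; rewrite eq_le ca ac.
  by rewrite /j (lintxx convP mw Phi_H) ?lexx ?(ltW ab)// /hnorm mdistxx.
have jdb : j d b = 0.
  have [ldb|bd] := ltP d b.
    by apply: zero => // s /andP[ds _]; exact: zr.
  have -> : d = b by apply/eqP; rewrite eq_le bd db.
  by rewrite /j (lintxx convP mw Phi_H) ?lexx ?(ltW ab)// /hnorm mdistxx.
rewrite /j (cat (d := c))// (cat (c := c) (d := d))//.
by rewrite -!/(j _ _) jac jdb add0r addr0.
Qed.


End Assembly.

(** * Equality in the transport estimates for embedded real functions *)

Section EmbeddedIntegrals.
Context {R : realType} {X : lspaceType R} (P : X -> X).
Hypothesis convP : convexifying_operator P.
Hypothesis isoX : isotropic X.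
Variables (a b : R) (w : R -> R).
Hypothesis mw : modulus_of_continuity w.
Variables (e : X).
Hypothesis (ce : convex_elements e) (e1 : hnorm e = 1).
Variable phi : R -> R.
Hypothesis phi_ge0 : forall s, 0 <= phi s.
Hypothesis phiH : forall s t, a <= s <= b -> a <= t <= b ->
  `|phi s - phi t| <= w `|s - t|.

Let j c d := hnorm (lint P (fun s => phi s *s e) c d).

Let cvg_r := cvg_real_mean_r convP isoX mw ce e1 phi_ge0 phiH.
Let cvg_l := cvg_real_mean_l convP isoX mw ce e1 phi_ge0 phiH.

Let cvg_r_scale (p A k : R) : 0 <= A -> a <= p -> p + A <= b ->
  k * A * real_mean phi p A n @[n --> \oo] --> k * j p (p + A).
Proof.
move=> A0 ap pb; under eq_fun do rewrite -mulrA.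
by apply: cvgM; [exact: cvg_cst|exact: cvg_r].
Qed.

Let cvg_l_scale (p A k : R) : 0 <= A -> a <= p - A -> p <= b ->
  k * A * real_mean phi p (- A) n @[n --> \oo] --> k * j (p - A) p.
Proof.
move=> A0 ap pb; under eq_fun do rewrite -mulrA.
by apply: cvgM; [exact: cvg_cst|exact: cvg_l].
Qed.

Lemma real_mean0 p n : real_mean phi p 0 n = phi p.
Proof.
rewrite /real_mean; under eq_bigr do rewrite mul0r addr0.
by rewrite -mulr_suml sumr_const card_ord -[_ *+ _]mulr_natr mulVf ?mul1r ?pnatr_eq0.
Qed.

Let I_mul (h : R) : h * (I_ w h / h) = I_ w h.
Proof.
by have [->|hn] := eqVneq h 0; rewrite ?mul0r ?I_0// mulrC divfK.
Qed.

Lemma embed_value_r (t h : R) : 0 <= h -> a <= t -> t + h <= b ->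
  (forall x, 0 <= x <= 1 -> phi t - phi (t + h * x) = w (h * x)) ->
  h * phi t - j t (t + h) = I_ w h.
Proof.
move=> h0 at_ tb phiE; rewrite -I_mul.
apply: (mean_diff mw (phi := phi) (p := t) (A := 0) (B := h) h0).
- by move=> x x01; rewrite mul0r addr0 phiE.
- by under eq_fun do rewrite real_mean0; exact: cvg_cst.
- exact: cvg_r.
Qed.

Lemma embed_value_l (t h : R) : 0 <= h -> a <= t - h -> t <= b ->
  (forall x, 0 <= x <= 1 -> phi t - phi (t - h * x) = w (h * x)) ->
  h * phi t - j (t - h) t = I_ w h.
Proof.
move=> h0 at_ tb phiE; rewrite -I_mul.
apply: (mean_diff mw (phi := phi) (p := t) (A := 0) (B := - h) h0).
- by move=> x x01; rewrite mul0r addr0 mulNr phiE.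
- by under eq_fun do rewrite real_mean0; exact: cvg_cst.
- exact: cvg_l.
Qed.

(** Equality case of [block_close], with the inner piece to the right of the pivot [p]. *)
Lemma embed_block_r (p L l alpha beta : R) : 0 <= L -> 0 <= l ->
  a <= p - l -> p + L <= b -> alpha * L = beta * l ->
  (forall x, 0 <= x <= 1 -> phi (p + L * x) - phi (p - l * x) = w ((L + l) * x)) ->
  alpha * j p (p + L) - beta * j (p - l) p = alpha * L * (I_ w (L + l) / (L + l)).
Proof.
move=> L0 l0 ap pb E phiE.
apply: (mean_diff mw (phi := phi) (p := p) (A := L) (B := - l) (addr_ge0 L0 l0)).
- by move=> x x01; rewrite mulNr phiE.
- by apply: cvg_r_scale => //; lra.
- by rewrite E; apply: cvg_l_scale => //; lra.
Qed.

Lemma embed_block_l (p L l alpha beta : R) : 0 <= L -> 0 <= l ->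
  a <= p - L -> p + l <= b -> alpha * L = beta * l ->
  (forall x, 0 <= x <= 1 -> phi (p - L * x) - phi (p + l * x) = w ((L + l) * x)) ->
  alpha * j (p - L) p - beta * j p (p + l) = alpha * L * (I_ w (L + l) / (L + l)).
Proof.
move=> L0 l0 ap pb E phiE.
apply: (mean_diff mw (phi := phi) (p := p) (A := - L) (B := l) (addr_ge0 L0 l0)).
- by move=> x x01; rewrite mulNr phiE.
- by apply: cvg_l_scale => //; lra.
- by rewrite E; apply: cvg_r_scale => //; lra.
Qed.

End EmbeddedIntegrals.

(** * The lower bound for the derivative *)

Section ExtremalFunctions.
Context {R : realType} {X : lspaceType R} (P : X -> X).
Hypothesis convP : convexifying_operator P.
Hypothesis isoX : isotropic X.
Variables (a b : R) (w : R -> R).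
Hypothesis mw : modulus_of_continuity w.
Hypothesis ab : a < b.
Hypothesis nontriv :
  invertible_elements `&` convex_elements <> [set (theta : X)].

Lemma E_ge0 (A : (R -> X) -> X) (N : R) : 0 <= N -> (0 <= E_ a b P w A N)%E.
Proof.
move=> N0; have [e [e' [ce ce' ee' e1]]] := unit_convex_invertible isoX nontriv.
have phiH (s t : R) : a <= s <= b -> a <= t <= b -> `|0 - 0 : R| <= w `|s - t|.
  by move=> _ _; rewrite subrr normr0 (modulus_ge0 mw).
apply: le_trans (E_lower_bound convP isoX mw ab ce ce' ee' e1 (phi := fun=> 0)
  _ phiH A N0) => //.
rewrite (embed_zero convP isoX mw ce e1 _ phiH)// ?(ltW ab)//.
by rewrite mul0r mulr0 subr0 lee_fin hnorm_ge0.
Qed.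

(** The test function decreases from [w h] at [t] exactly as [w] does and vanishes at distance [h].
    A side shorter than [h] ends at an end of [[a, b]], so no mass lies outside
    [[t - h1, t + h2]]. *)
Lemma hderivative_lower_bound (t h h1 h2 : R) : a <= t <= b -> 0 <= h1 ->
  0 <= h2 -> h1 <= h -> h2 <= h -> 0 < h1 + h2 -> a <= t - h1 -> t + h2 <= b ->
  (a < t - h1 -> h1 = h) -> (t + h2 < b -> h2 = h) ->
  (((I_ w h1 + I_ w h2) / (h1 + h2))%:E <=
    E_ a b P w (hderivative a b t) (2 / (h1 + h2)))%E.
Proof.
move=> tab h10 h20 h1h h2h H0 ta tb hl hr.
have [e [e' [ce ce' ee' e1]]] := unit_convex_invertible isoX nontriv.
have h0 : 0 <= h by exact: le_trans h1h.
pose phi s := Num.max 0 (w h - w `|s - t|).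
have phi_ge0 s : 0 <= phi s by rewrite /phi le_max lexx.
have phiH s s' : a <= s <= b -> a <= s' <= b -> `|phi s - phi s'| <= w `|s - s'|.
  move=> _ _; apply: le_trans (max0_dist _ _) _.
  rewrite opprB addrC addrA subrK; apply: le_trans (modulus_dist mw _ _) _ => //.
  apply: (modulus_nondecreasing mw) => //; rewrite distrC.
  apply: le_trans (ler_dist_dist _ _) _.
  by rewrite opprB addrA subrK.
have phi_near s : `|s - t| <= h -> phi s = w h - w `|s - t|.
  move=> sth; rewrite /phi max_r// subr_ge0.
  exact: (modulus_nondecreasing mw).
have phi_far s : h <= `|s - t| -> phi s = 0.
  move=> hst; rewrite /phi max_l// subr_le0.
  exact: (modulus_nondecreasing mw).
have phi_far_l s : s <= t - h -> phi s = 0.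
  rewrite lerBrDr -lerBrDl => hs; apply: phi_far.
  by rewrite distrC (le_trans hs)// ler_norm.
have phi_far_r s : t + h <= s -> phi s = 0.
  by rewrite -lerBrDl => hs; apply: phi_far; rewrite (le_trans hs)// ler_norm.
have phit : phi t = w h by rewrite phi_near subrr normr0// (modulus0 mw) subr0.
have Hphi := embed_H_class isoX ce e1 phi_ge0 phiH.
have phi_diff k x : 0 <= k -> k <= h -> 0 <= x <= 1 ->
    phi t - phi (t + k * x) = w (k * x) /\ phi t - phi (t - k * x) = w (k * x).
  move=> k0 kh /andP[x0 x1].
  have kx0 : 0 <= k * x by rewrite mulr_ge0.
  have kxh : k * x <= h by apply: le_trans kh; rewrite ler_piMr.
  have nE : `|t + k * x - t| = k * x by rewrite addrAC subrr add0r ger0_norm.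
  have nE' : `|t - k * x - t| = k * x.
    by rewrite addrAC subrr add0r normrN ger0_norm.
  by rewrite phit !phi_near ?nE ?nE'//; split; ring.
have V2 := embed_value_r convP isoX mw ce e1 phi_ge0 phiH h20
  (andP tab).1 tb (fun x x01 => (phi_diff h2 x h20 h2h x01).1).
have V1 := embed_value_l convP isoX mw ce e1 phi_ge0 phiH h10
  ta (andP tab).2 (fun x x01 => (phi_diff h1 x h10 h1h x01).2).
have lt1 : t - h1 <= t by rewrite gerBl.
have lt2 : t <= t + h2 by rewrite lerDl.
have lt12 := le_trans lt1 lt2.
have J := embed_support convP isoX mw ab ce e1 phi_ge0 phiH ta lt12 tb.
have C := embed_cat convP isoX mw ce e1 phi_ge0 phiH ta lt1 lt2 tb.
have N0 : 0 <= 2 / (h1 + h2) by rewrite divr_ge0// ltW.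
apply: le_trans (E_lower_bound convP isoX mw ab ce ce' ee' e1 phi_ge0 phiH _ N0).
rewrite lee_fin (primitive_hderivative convP isoX mw Hphi ab tab); last first.
  exact: (extremal_primitive convP isoX mw e' ce e1 phi_ge0 phiH).
rewrite (convexifying_fix convP); last exact: convex_slscale.
rewrite hnorm_slscale e1 mulr1 ger0_norm// J.
- rewrite C -V1 -V2 ler_pdivrMr// le_eqVlt; apply/orP; left; apply/eqP.
  by field; rewrite lt0r_neq0.
- by move=> /hl -> s; exact: phi_far_l.
- by move=> /hr -> s; exact: phi_far_r.
Qed.

End ExtremalFunctions.

(** * The extremal function for divided differences *)

Section ConcaveExtremal.
Context {R : realType} (w : R -> R).
Hypothesis mw : modulus_of_continuity w.
Hypothesis cw : concave_modulus w.
Variables G d1 d2 pl pr : R.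
Hypothesis (G0 : 0 < G) (d10 : 0 <= d1) (d20 : 0 <= d2) (D0 : 0 < d1 + d2).
Hypothesis plr : pl + G = pr.

Let D := d1 + d2.
Let q1 := G * d1 / D.
Let q2 := G * d2 / D.
Let c := pl + q1.

Let Dn : D != 0. Proof. exact: lt0r_neq0. Qed.
Let q10 : 0 <= q1. Proof. by rewrite /q1 divr_ge0 ?mulr_ge0// ltW. Qed.
Let q20 : 0 <= q2. Proof. by rewrite /q2 divr_ge0 ?mulr_ge0// ltW. Qed.
Let cE : c = pr - q2.
Proof. by rewrite /c /q1 /q2 -plr /D; field. Qed.

Let psi := two_sided_profile w G D pl pr c.
(** The depths of [psi] at [pl - d1] and [pr + d2]; raising by the larger one makes [M + psi]
    nonnegative between these points, so the truncation in [phi] acts only outside. *)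
Let M := Num.max (w ((G + D) * d1 / D)) (w ((G + D) * d2 / D)).
Let phi s := Num.max 0 (M + psi s).

Let psi_l s : s <= c -> psi s = profile w G D (s - pl) - profile w G D q1.
Proof.
move=> sc; rewrite /psi two_sided_profile_l//.
by rewrite [in X in _ - profile _ _ _ X]/c [pl + q1]addrC addrK.
Qed.

Let psi_r s : c <= s -> psi s = profile w G D (pr - s) - profile w G D q2.
Proof.
move=> cs; rewrite /psi two_sided_profile_r//; congr (_ - profile _ _ _ _).
by rewrite cE opprB addrC subrK.
Qed.

Let psi_end_l : psi (pl - d1) = - w ((G + D) * d1 / D).
Proof.
rewrite psi_l; last by rewrite /c; move: q10 d10; lra.
rewrite addrAC subrr add0r -opprB; congr (- _).
have x0 : 0 <= d1 / D by rewrite divr_ge0// ltW.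
have := profile_opp mw G0 D0 x0; rewrite -/D mulrA -/q1 => E.
by rewrite -mulrA -E; congr (_ - profile _ _ _ _); rewrite mulrC divfK.
Qed.

Let psi_end_r : psi (pr + d2) = - w ((G + D) * d2 / D).
Proof.
rewrite psi_r; last by rewrite cE; move: q20 d20; lra.
rewrite opprD addrA subrr add0r -opprB; congr (- _).
have x0 : 0 <= d2 / D by rewrite divr_ge0// ltW.
have := profile_opp mw G0 D0 x0; rewrite -/D mulrA -/q2 => E.
by rewrite -mulrA -E; congr (_ - profile _ _ _ _); rewrite mulrC divfK.
Qed.

Let psi_incr s s' : s <= s' -> s' <= c -> psi s <= psi s'.
Proof.
move=> ss sc; rewrite !psi_l ?(le_trans ss)// lerD2r.
by apply: profile_incr => //; rewrite lerD2r.
Qed.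

Let psi_decr s s' : c <= s -> s <= s' -> psi s' <= psi s.
Proof.
move=> cs ss; rewrite !psi_r ?(le_trans cs)// lerD2r.
by apply: profile_incr => //; rewrite lerD2l lerN2.
Qed.

Let c_l : pl - d1 <= c. Proof. by rewrite /c; move: q10 d10; lra. Qed.
Let c_r : c <= pr + d2. Proof. by rewrite cE; move: q20 d20; lra. Qed.

Let phi_in s : pl - d1 <= s <= pr + d2 -> phi s = M + psi s.
Proof.
move=> /andP[ls sr]; rewrite /phi max_r// -lerBlDl sub0r.
have [sc|/ltW cs] := leP s c.
  apply: le_trans (psi_incr ls sc); rewrite psi_end_l lerN2.
  by rewrite le_max lexx.
apply: le_trans (psi_decr cs sr); rewrite psi_end_r lerN2.
by rewrite le_max lexx orbT.
Qed.

(** The function reaches 0 at the outer end of the longer block, where [M] equals the depth of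
    [psi]. At the other end it may stay positive, hence the conditions on [d1] and [d2]. *)
Lemma concave_extremal : exists f : R -> R,
  [/\ forall s, 0 <= f s, forall s s', `|f s - f s'| <= w `|s - s'|,
     (forall x, 0 <= x <= 1 ->
        f (pl + q1 * x) - f (pl - d1 * x) = w ((q1 + d1) * x)) /\
     (forall x, 0 <= x <= 1 ->
        f (pr - q2 * x) - f (pr + d2 * x) = w ((q2 + d2) * x)),
     d2 <= d1 -> forall s, s <= pl - d1 -> f s = 0
   & d1 <= d2 -> forall s, pr + d2 <= s -> f s = 0].
Proof.
have HD0 : 0 <= (G + D) / D by rewrite divr_ge0 ?addr_ge0// ltW.
exists phi; split.
- by move=> s; rewrite /phi le_max lexx.
- move=> s s'; apply: le_trans (max0_dist _ _) _.
  rewrite opprD addrACA subrr add0r.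
  exact: two_sided_profile_dist.
- split=> x /andP[x0 x1].
    have dx0 : 0 <= d1 * x by rewrite mulr_ge0.
    have dx1 : d1 * x <= d1 by rewrite ler_piMr.
    have qx0 : 0 <= q1 * x by rewrite mulr_ge0.
    have qx1 : q1 * x <= q1 by rewrite ler_piMr.
    have in1 : pl - d1 <= pl + q1 * x <= pr + d2.
      by move: c_r; rewrite /c => ?; apply/andP; split; lra.
    have in2 : pl - d1 <= pl - d1 * x <= pr + d2.
      by move: c_r; rewrite /c => ?; apply/andP; split; lra.
    rewrite !phi_in// !psi_l; [|rewrite /c; lra|rewrite /c; lra].
    (* With [y = d1 * x / D] the two paired points are [G * y = q1 * x] and [- (D * y) = - (d1 * x)]
       relative to [pl]. *)
    have y0 : 0 <= d1 * x / D by rewrite divr_ge0// ltW.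
    have := profile_opp mw G0 D0 y0; rewrite -/D.
    rewrite [D * _]mulrC divfK// => E.
    rewrite (_ : (q1 + d1) * x = (G + D) * (d1 * x / D)); last first.
      by rewrite /q1; field.
    rewrite -E (_ : G * (d1 * x / D) = q1 * x); last by rewrite /q1; field.
    rewrite (_ : pl + q1 * x - pl = q1 * x); last ring.
    rewrite (_ : pl - d1 * x - pl = - (d1 * x)); last ring.
    ring.
  have dx0 : 0 <= d2 * x by rewrite mulr_ge0.
  have dx1 : d2 * x <= d2 by rewrite ler_piMr.
  have qx0 : 0 <= q2 * x by rewrite mulr_ge0.
  have qx1 : q2 * x <= q2 by rewrite ler_piMr.
  have in1 : pl - d1 <= pr - q2 * x <= pr + d2.
    by move: c_l; rewrite cE => ?; apply/andP; split; lra.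
  have in2 : pl - d1 <= pr + d2 * x <= pr + d2.
    by move: c_l; rewrite cE => ?; apply/andP; split; lra.
  rewrite !phi_in// !psi_r; [|rewrite cE; lra|rewrite cE; lra].
  have y0 : 0 <= d2 * x / D by rewrite divr_ge0// ltW.
  have := profile_opp mw G0 D0 y0; rewrite -/D.
  rewrite [D * _]mulrC divfK// => E.
  rewrite (_ : (q2 + d2) * x = (G + D) * (d2 * x / D)); last first.
    by rewrite /q2; field.
  rewrite -E (_ : G * (d2 * x / D) = q2 * x); last by rewrite /q2; field.
  rewrite (_ : pr - (pr - q2 * x) = q2 * x); last ring.
  rewrite (_ : pr - (pr + d2 * x) = - (d2 * x)); last ring.
  ring.
- move=> d21 s sl; rewrite /phi max_l// -lerBrDl sub0r.
  apply: le_trans (psi_incr sl c_l) _; rewrite psi_end_l lerN2 ge_max lexx /=.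
  apply: (modulus_nondecreasing mw).
    by rewrite mulrAC mulr_ge0.
  by rewrite mulrAC [leRHS]mulrAC ler_wpM2l.
- move=> d12 s sr; rewrite /phi max_l// -lerBrDl sub0r.
  apply: le_trans (psi_decr c_r sr) _; rewrite psi_end_r lerN2 ge_max lexx andbT.
  apply: (modulus_nondecreasing mw).
    by rewrite mulrAC mulr_ge0.
  by rewrite mulrAC [leRHS]mulrAC ler_wpM2l.
Qed.

End ConcaveExtremal.

(** * The lower bound for divided differences *)

Section DividedDifferenceLowerBound.
Context {R : realType} {X : lspaceType R} (P : X -> X).
Hypothesis convP : convexifying_operator P.
Hypothesis isoX : isotropic X.
Variables (a b : R) (w : R -> R).
Hypothesis mw : modulus_of_continuity w.
Hypothesis ab : a < b.
Hypothesis nontriv :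
  invertible_elements `&` convex_elements <> [set (theta : X)].

Lemma divided_difference_lower_bound (t g1 g2 h1 h2 : R) :
  concave_modulus w -> 0 <= g1 -> 0 <= g2 -> g1 <= h1 -> g2 <= h2 ->
  0 < g1 + g2 -> a <= t - h1 -> t + h2 <= b ->
  (a < t - h1 -> h2 - g2 <= h1 - g1) -> (t + h2 < b -> h1 - g1 <= h2 - g2) ->
  ((K_ w g1 g2 h1 h2)%:E <=
    E_ a b P w (divided_difference g1 g2 t) (2 / (h1 + h2)))%E.
Proof.
(* With [u = (g1 + g2)^-1], [v = (h1 + h2)^-1] and the integrals over four consecutive blocks, the
   two block equalities add up to the expression bounded in [E_lower_bound]. *)
have balance (u v j1 j2 j3 j4 : R) : (u - v) * j2 - v * j1 + ((u - v) * j3 - v * j4)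
    = u * (j2 + j3) - 2 * v * ((j1 + (j2 + j3 + j4)) / 2) by field.
move=> cw g10 g20 gh1 gh2 G0 ta tb dl dr.
have H0 : 0 < h1 + h2 by apply: lt_le_trans G0 _; exact: lerD.
have N0 : 0 <= 2 / (h1 + h2) by rewrite divr_ge0// ltW.
(* Here [K_] is zero, and nonnegativity of [E_] suffices. *)
have [D0|Dn] := eqVneq ((h1 - g1) + (h2 - g2)) 0.
  by rewrite /K_ D0 !mul0r; exact: E_ge0.
have [e [e' [ce ce' ee' e1]]] := unit_convex_invertible isoX nontriv.
have d10 : 0 <= h1 - g1 by rewrite subr_ge0.
have d20 : 0 <= h2 - g2 by rewrite subr_ge0.
have D0 : 0 < (h1 - g1) + (h2 - g2) by rewrite lt_neqAle eq_sym Dn addr_ge0.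
have plr : t - g1 + (g1 + g2) = t + g2 by ring.
have [phi [phi_ge0 phiw [block1 block2] zl zr]] :=
  concave_extremal mw cw G0 d10 d20 D0 plr.
have phiH s s' : a <= s <= b -> a <= s' <= b -> `|phi s - phi s'| <= w `|s - s'|.
  by move=> _ _; exact: phiw.
have Hphi := embed_H_class isoX ce e1 phi_ge0 phiH.
apply: le_trans (E_lower_bound convP isoX mw ab ce ce' ee' e1 phi_ge0 phiH _ N0).
have fE := extremal_primitive convP isoX mw e' ce e1 phi_ge0 phiH.
rewrite lee_fin (primitive_divided_difference isoX g10 g20 _ _ fE); [|lra|lra].
rewrite hnorm_slscale gtr0_norm ?invr_gt0//.
have th12 : t - h1 <= t + h2 by lra.
have E1 : t - g1 - (h1 - g1) = t - h1 by ring.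
have E2 : t + g2 + (h2 - g2) = t + h2 by ring.
rewrite E1 in zl; rewrite E2 in zr.
rewrite (embed_support convP isoX mw ab ce e1 phi_ge0 phiH ta th12 tb); last 2 first.
- by move=> /dl; exact: zl.
- by move=> /dr; exact: zr.
have cat := embed_cat convP isoX mw ce e1 phi_ge0 phiH.
have B1 := embed_block_r convP isoX mw ce e1 phi_ge0 phiH
  (p := t - g1) (alpha := (g1 + g2)^-1 - (h1 + h2)^-1) (beta := (h1 + h2)^-1)
  _ d10 _ _ _ block1.
have B2 := embed_block_l convP isoX mw ce e1 phi_ge0 phiH
  (p := t + g2) (alpha := (g1 + g2)^-1 - (h1 + h2)^-1) (beta := (h1 + h2)^-1)
  _ d20 _ _ _ block2.
move: B1 B2; rewrite E1 E2.
have HE : h1 + h2 = (g1 + g2) + ((h1 - g1) + (h2 - g2)) by ring.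
rewrite /K_.
set q1 := (g1 + g2) * (h1 - g1) / _; set q2 := (g1 + g2) * (h2 - g2) / _.
have q10 : 0 <= q1 by rewrite /q1 divr_ge0 ?mulr_ge0// ltW.
have q20 : 0 <= q2 by rewrite /q2 divr_ge0 ?mulr_ge0// ltW.
have qG : q1 + q2 = g1 + g2 by rewrite /q1 /q2; field.
have cE : t + g2 - q2 = t - g1 + q1 by lra.
have mE d : ((g1 + g2)^-1 - (h1 + h2)^-1) *
    ((g1 + g2) * d / ((h1 - g1) + (h2 - g2))) = (h1 + h2)^-1 * d.
  rewrite HE; field; rewrite -HE !lt0r_neq0//.
have C1 := block_constant w (h1 - g1) G0 D0.
have C2 := block_constant w (h2 - g2) G0 D0.
rewrite -HE -/q1 in C1; rewrite -HE -/q2 in C2.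
have p0 : a <= t - g1 by lra.
have p0' : t + g2 <= b by lra.
have pc1 : t - g1 <= t - g1 + q1 by rewrite lerDl.
have pc2 : t - g1 + q1 <= t + g2 by rewrite -cE gerBl.
have p01 : t - h1 <= t - g1 by rewrite lerD2l lerN2.
have p23 : t + g2 <= t + h2 by rewrite lerD2l.
rewrite cE => B1 B2.
have {}B1 := B1 q10 ta (le_trans pc2 p0') (mE _).
have {}B2 := B2 q20 (le_trans p0 pc1) tb (mE _).
rewrite C1 in B1; rewrite C2 in B2.
have p12 := le_trans pc1 pc2.
rewrite (cat _ (t - g1) _ ta p01 (le_trans p12 p23) tb).
rewrite (cat _ (t + g2) _ p0 p12 p23 tb) (cat _ _ _ p0 pc1 pc2 p0').
by rewrite mulrDr -B1 -B2 balance.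
Qed.


End DividedDifferenceLowerBound.

Theorem theorem9 (R : realType) (X : lspaceType R) (P : X -> X)
    (omega : R -> R) (a b t gamma h : R)
    (isoX : isotropic X)
    (nontriv : invertible_elements `&` convex_elements <> [set (theta : X)])
    (convP : convexifying_operator P)
    (modw : modulus_of_continuity omega)
    (ltab : a < b) (tab : t \in `[a, b])
    (gamma_gt0 : 0 < gamma) (lt_gamma_h : gamma < h) :
  let gamma1 := Num.min gamma (t - a) in
  let gamma2 := Num.min gamma (b - t) in
  let h1 := Num.min h (t - a) in
  let h2 := Num.min h (b - t) in
  (concave_modulus omega ->
     E_ a b P omega (divided_difference gamma1 gamma2 t) (2 / (h1 + h2)) =
       U_ a b P omega (divided_difference gamma1 gamma2 t)
                      (divided_difference h1 h2 t) /\
     U_ a b P omega (divided_difference gamma1 gamma2 t)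
                    (divided_difference h1 h2 t) =
       (K_ omega gamma1 gamma2 h1 h2)%:E) /\
  (E_ a b P omega (hderivative a b t) (2 / (h1 + h2)) =
     U_ a b P omega (hderivative a b t) (divided_difference h1 h2 t) /\
   U_ a b P omega (hderivative a b t) (divided_difference h1 h2 t) =
     ((I_ omega h1 + I_ omega h2) / (h1 + h2))%:E).
Proof.
move=> g1 g2 h1 h2; move: (tab); rewrite in_itv /= => tab'.
have /andP[at_ tb] := tab'.
have hgt0 : 0 < h by exact: lt_trans lt_gamma_h.
have minP (x y : R) : [/\ Num.min x y <= x, Num.min x y <= y &
    Num.min x y < y -> Num.min x y = x].
  by rewrite /Num.min; case: (ltP x y) => xy; split => //; rewrite ?lexx ?ltW ?ltxx.
have [h1h h1t h1E] := minP h (t - a); have [h2h h2t h2E] := minP h (b - t).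
have [g1g g1t g1E] := minP gamma (t - a).
have [g2g g2t g2E] := minP gamma (b - t).
have min_ge0 (x y : R) : 0 < x -> 0 <= y -> 0 <= Num.min x y.
  by move=> x0 y0; rewrite le_min (ltW x0).
have ta0 : 0 <= t - a by rewrite subr_ge0.
have bt0 : 0 <= b - t by rewrite subr_ge0.
(* Because [a < b], at least one of [t - a] and [b - t] is positive. *)
have sum_gt0 (x : R) : 0 < x -> 0 < Num.min x (t - a) + Num.min x (b - t).
  move=> x0; have [ta|ta] := ltP 0 (t - a).
    by rewrite ltr_pwDl ?min_ge0// lt_min x0.
  by rewrite ltr_wpDl ?min_ge0// lt_min x0; lra.
have gh1 : g1 <= h1 by rewrite /g1 /h1 le_min g1t (le_trans g1g)// ltW.
have gh2 : g2 <= h2 by rewrite /g2 /h2 le_min g2t (le_trans g2g)// ltW.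
(* The outer block has length at most [h - gamma], with equality on a side that does not reach the
   end of [[a, b]]. Such a side carries the longer block, and there the extremal function
   vanishes. *)
have incr_le (y : R) : Num.min h y - Num.min gamma y <= h - gamma.
  by rewrite /Num.min; case: (ltP h y) => hy; case: (ltP gamma y) => gy; lra.
have full (y : R) : Num.min h y < y -> Num.min h y - Num.min gamma y = h - gamma.
  by rewrite /Num.min; case: (ltP h y) => hy; case: (ltP gamma y) => gy; lra.
have th1 : a <= t - h1 by rewrite lerBrDl -lerBrDr.
have th2 : t + h2 <= b by rewrite -lerBrDl.
have h10 : 0 <= h1 by exact: min_ge0.
have h20 : 0 <= h2 by exact: min_ge0.
have g10 : 0 <= g1 by exact: min_ge0.
have g20 : 0 <= g2 by exact: min_ge0.
have al : (a < t - h1) = (h1 < t - a) by rewrite ltrBrDl -ltrBrDr.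
have bl : (t + h2 < b) = (h2 < b - t) by rewrite -ltrBrDl.
have H0 := sum_gt0 _ hgt0; have G0 := sum_gt0 _ gamma_gt0.
split=> [cw|].
  apply: optimal_recovery => // [f /(W1H_primitive convP modw)|].
    move=> [phi Hphi fE].
    rewrite (primitive_divided_difference isoX g10 g20 _ _ fE); [|lra|lra].
    rewrite (primitive_divided_difference isoX h10 h20 th1 th2 fE).
    exact: (mean_mean_close convP modw Hphi).
  apply: divided_difference_lower_bound => //.
    by rewrite al => /full; rewrite -/h1 -/g1 => ->; exact: incr_le.
  by rewrite bl => /full; rewrite -/h2 -/g2 => ->; exact: incr_le.
apply: optimal_recovery => // [f /(W1H_primitive convP modw)|].
  move=> [phi Hphi fE].
  rewrite (primitive_hderivative convP isoX modw Hphi ltab tab' fE).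
  rewrite (primitive_divided_difference isoX h10 h20 th1 th2 fE).
  exact: (value_mean_close convP modw Hphi).
apply: (@hderivative_lower_bound _ _ _ _ _ _ _ _ _ _ _ _ h) => //.
  by rewrite al => /h1E.
by rewrite bl => /h2E.
Qed.
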